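(* Let $p\in\mathbb{S}^2$ and let $$A=\frac{2}{1+\log\pi}+\frac{8}{\pi^2(1+\log 2)^2},\qquad B=\frac{2}{1+\log\pi}+\frac{8}{\pi^2(1+\log\pi)^2}.$$ Then there is no $f\in H^1(\mathbb{S}^2)\setminus\{0\}$ such that $Q(f;\phi)=T_A(f)$, and there is no $f\in H^1(\mathbb{S}^2)\setminus\{0\}$ such that $Q(f;\psi)=T_B(f)$.
   Context: $\mathbb{S}^2\subset\mathbb{R}^3$ is the unit sphere with its surface measure $\sigma$ (in spherical coordinates $d\sigma=\sin\theta\,d\theta\,d\varphi$), $\nabla$ is the (weak) gradient on $\mathbb{S}^2$, and $d(x,p)\in[0,\pi]$ is the geodesic distance from $x$ to the fixed point $p$. $H^1(\mathbb{S}^2)$ is the real Sobolev space obtained as the completion of $C^\infty(\mathbb{S}^2)$ in the norm $\left(\|f\|_{L^2}^2+\|\nabla f\|_{L^2}^2\right)^{1/2}$; equivalently, the functions in $L^2(\mathbb{S}^2)$ whose weak gradient is in $L^2$. For $t\in(0,\pi]$ put $\phi(t)=\log(\pi e/t)$, and for $t\in(0,\pi)$ put $\psi(t)=\phi(\sin t)=\log(\pi e/\sin t)$. For $\chi\in\{\phi,\psi\}$ let $\rho_\chi(t)=t\,\chi(t)$ and $$Q(f;\chi)=\frac14\int_{\mathbb{S}^2}\left(\frac{f(x)^2}{\rho_\chi(d(x,p))^2}+\frac{f(x)^2}{\rho_\chi(\pi-d(x,p))^2}\right)d\sigma(x)$$ (the integrand is defined off the two points $p$ and $-p$, which have measure zero).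 For a constant $C>0$ let $$T_C(f)=\int_{\mathbb{S}^2}|\nabla f|^2\,d\sigma+\frac{C}{4}\int_{\mathbb{S}^2}f^2\,d\sigma.$$ *)

(* Defs.v *)
From HB Require Import structures.
From mathcomp Require Import all_boot all_order all_algebra.
From mathcomp Require Import all_classical all_reals all_analysis.
From mathcomp Require Import measurable_realfun.

Set Implicit Arguments.
Unset Strict Implicit.
Unset Printing Implicit Defensive.

Import Order.TTheory GRing.Theory Num.Theory numFieldNormedType.Exports.

Local Open Scope classical_set_scope.
Local Open Scope ring_scope.

(* Euclidean 3-space is the triple product, because this type carries both the
   product sigma-algebra and a normed-module structure.  The library norm `|x|
   on it is the max norm: the Euclidean one is [enorm]. *)
Notation R3 R := (R * R * R)%type.

Section space.
Variable R : realType.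
Implicit Types x y : R3 R.

Definition dot x y : R := x.1.1 * y.1.1 + x.1.2 * y.1.2 + x.2 * y.2.

Definition enorm x : R := Num.sqrt (dot x x).

Definition sphere : set (R3 R) := [set x | enorm x = 1].

Definition geodist x y : R := acos (dot x y).

End space.

Arguments sphere {R}.

Section surface_measure.
Variable R : realType.

Definition sph (z : R * R) : R3 R :=
  (sin z.1 * cos z.2, sin z.1 * sin z.2, cos z.1).

Definition sph_dom : set (R * R) := `[0, pi] `*` `[0, 2 * pi].

Lemma measurable_sph : measurable_fun setT sph.
Proof.
have ms (f : R -> R) (g : R * R -> R) : continuous f -> measurable_fun setT g ->
    measurable_fun setT (f \o g).
  by move=> cf mg; apply: measurableT_comp => //; exact: continuous_measurable_fun.
have s1 : measurable_fun setT (fun z : R * R => sin z.1).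
  by apply: ms; [exact: continuous_sin | exact: measurable_fst].
have s2 : measurable_fun setT (fun z : R * R => sin z.2).
  by apply: ms; [exact: continuous_sin | exact: measurable_snd].
have c1 : measurable_fun setT (fun z : R * R => cos z.1).
  by apply: ms; [exact: continuous_cos | exact: measurable_fst].
have c2 : measurable_fun setT (fun z : R * R => cos z.2).
  by apply: ms; [exact: continuous_cos | exact: measurable_snd].
apply: measurable_fun_pair => //; apply: measurable_fun_pair.
  exact: measurable_funM.
exact: measurable_funM.
Qed.

Lemma measurable_sph_dom : measurable sph_dom.
Proof. by apply: measurableX; exact: measurable_itv. Qed.

(* The surface measure, as a Borel measure on the whole space carried by the
   sphere: the image under [sph] of sin theta dtheta dphi. *)
Definition sigma (A : set (R3 R)) : \bar R :=
  (\int[(@lebesgue_measure R \x @lebesgue_measure R)%E]_(z in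
      sph_dom `&` sph @^-1` A) (sin z.1)%:E)%E.

Let sigma0 : sigma set0 = 0%E.
Proof. by rewrite /sigma preimage_set0 setI0 integral_set0. Qed.

Let sin_ge0_dom A z : (sph_dom `&` A) z -> (0 <= (sin z.1)%:E)%E.
Proof. by move=> [[/= z1 _] _]; rewrite lee_fin sin_ge0_pi. Qed.

Let sigma_ge0 A : (0 <= sigma A)%E.
Proof. by apply: integral_ge0 => z /sin_ge0_dom. Qed.

Let sigma_additive : semi_sigma_additive sigma.
Proof.
move=> F mF tF _.
have mP k : measurable (sph_dom `&` sph @^-1` F k).
  apply: measurableI; first exact: measurable_sph_dom.
  by rewrite -[X in measurable X]setTI; exact: measurable_sph.
rewrite [X in _ --> X](_ : _ = (\sum_(i <oo) sigma (F i))%E); last first.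
  rewrite /sigma preimage_bigcup setI_bigcupr ge0_integral_bigcup //.
  - apply: measurable_funTS; apply/measurable_EFinP.
    apply: measurableT_comp; last exact: measurable_fst.
    by apply: continuous_measurable_fun; exact: continuous_sin.
  - by move=> z [k _ /sin_ge0_dom].
  - apply/trivIsetP => i j _ _ ij.
    move/trivIsetP : tF => /(_ i j Logic.I Logic.I ij) Fij.
    by rewrite setIACA setIid -preimage_setI Fij preimage_set0 setI0.
by apply: is_cvg_ereal_nneg_natsum_cond => n _ _; exact: sigma_ge0.
Qed.

HB.instance Definition _ :=
  isMeasure.Build _ _ _ sigma sigma0 sigma_ge0 sigma_additive.

End surface_measure.

Arguments sigma {R}.

Section sobolev.
Variable R : realType.
Local Open Scope ereal_scope.

(* C^oo on an open set: every iterated directional derivative (in particular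
   the function itself) is Frechet differentiable there. *)
Definition smooth_on (D : set (R3 R)) (F : R3 R -> R) : Prop :=
  forall (s : seq (R3 R)) x, D x ->
    differentiable (foldr (fun v (g : R3 R -> R) y => 'D_v g y) F s) x.

(* Functions on the sphere are functions on the whole space of which only the
   values on the sphere matter; [homext u] is the 0-homogeneous extension of
   the restriction of u. *)
Definition homext (u : R3 R -> R) (x : R3 R) : R := u ((enorm x)^-1 *: x)%R.

Definition smooth_sphere (u : R3 R -> R) : Prop :=
  smooth_on [set x | x != 0%R] (homext u).

(* For x on the sphere, ('D_v (homext u) x) is the derivative of u along the
   curve t |-> (x + t v) / |x + t v| of the sphere, whose velocity at t = 0 is
   the tangential part of v.  Hence this vector is tangent to the sphere and is
   the Riemannian gradient of u. *)
Definition grad (u : R3 R -> R) (x : R3 R) : R3 R :=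
  ('D_((1, 0, 0)%R : R3 R) (homext u) x,
   'D_((0, 1, 0)%R : R3 R) (homext u) x,
   'D_((0, 0, 1)%R : R3 R) (homext u) x).

Definition sqnormL2 (f : R3 R -> R) : \bar R :=
  \int[sigma]_(x in sphere) (f x ^+ 2)%:E.

Definition sqnormL2v (G : R3 R -> R3 R) : \bar R :=
  \int[sigma]_(x in sphere) (enorm (G x) ^+ 2)%:E.

(* The completion of C^oo(S^2) in the H^1 norm, realized inside L^2: f is an
   element with gradient G when (f, G) is the limit in L^2 x L^2 of a sequence
   (u n, grad (u n)) with the u n smooth. *)
Definition H1_gradient (f : R3 R -> R) (G : R3 R -> R3 R) : Prop :=
  [/\ measurable_fun sphere f /\ sqnormL2 f < +oo,
      measurable_fun sphere G /\ sqnormL2v G < +oo &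
      exists u : nat -> R3 R -> R,
        [/\ forall n, smooth_sphere (u n),
            sqnormL2 (fun x => u n x - f x)%R @[n --> \oo] --> 0 &
            sqnormL2v (fun x => grad (u n) x - G x)%R @[n --> \oo] --> 0]].

Definition H1 (f : R3 R -> R) : Prop := exists G, H1_gradient f G.

(* The gradient is unique up to a sigma-null set; one version is chosen. *)
Definition wgrad (f : R3 R -> R) : R3 R -> R3 R :=
  xget (cst 0%R) [set G | H1_gradient f G].

(* f is the zero element of H^1. *)
Definition H1_zero (f : R3 R -> R) : Prop := ae_eq sigma sphere f (cst 0%R).

End sobolev.

Section functionals.
Variable R : realType.

Definition phi (t : R) : R := ln (pi * expR 1 / t).

Definition psi (t : R) : R := phi (sin t).

Definition rho (chi : R -> R) (t : R) : R := t * chi t.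

Local Open Scope ereal_scope.

Definition Q (p : R3 R) (chi : R -> R) (f : R3 R -> R) : \bar R :=
  (4^-1)%:E * \int[sigma]_(x in sphere `\` [set p; (- p)%R])
    (f x ^+ 2 / rho chi (geodist x p) ^+ 2
     + f x ^+ 2 / rho chi (pi - geodist x p) ^+ 2)%:E.

Definition T (C : R) (f : R3 R -> R) : \bar R :=
  sqnormL2v (wgrad f) + (C / 4)%:E * sqnormL2 f.

End functionals.

(* Main.v *)
From HB Require Import structures.
Require Import Defs.
From mathcomp Require Import all_boot all_order all_algebra.
From mathcomp Require Import all_classical all_reals all_analysis.
From mathcomp Require Import measurable_realfun.
From mathcomp Require Import ring lra.

(** Why neither functional has an extremal.

    Write w = x . p = cos theta, c = 1 + ln pi, and let psi = c - ln sin theta.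

    Hardy inequalities on the sphere.  Let g be a C^1 function on [-1, 1] and
    X = g(w) (p - w x), which is a tangent vector field.  Expanding
    |grad u - u X|^2 >= 0 and integrating by parts gives, for smooth u,

      int |grad u|^2 >= int u^2 W(w),
      W(t) = - g'(t) (1 - t^2) + 2 t g(t) - g(t)^2 (1 - t^2).

    The integration by parts is done in spherical coordinates, where sin theta
    times the divergence of a field is a sum of a theta-derivative and of a
    phi-derivative ([integral_div_field], [hardy_smooth]).  The coordinates are
    centred at the third basis vector while p is arbitrary, so no rotation
    invariance of the measure is called for.  As W is bounded when g is C^1, the
    inequality passes to H^1 by density ([hardy_H1]).

    The extremal potential.  The function psi^(1/2) is a positive function whose
    logarithmic gradient is X for g(t) = t / (2 (1 - t^2) psi); the corresponding
    potential is W = cot^2 theta / (4 psi^2) - 1 / (2 psi).  This g blows up at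
    the poles, so 1 - t^2 is replaced by 1 + e - t^2, which keeps W >= - 1, and
    Fatou's lemma is applied as e tends to 0 ([hardy_limit_inequality]).

    The elementary comparison.  For the chi and the constant C of either
    functional,

      (1 / rho(theta)^2 + 1 / rho(pi - theta)^2) / 4
         <= C / 4 + cot^2 theta / (4 psi^2) - 1 / (2 psi)

    on (0, pi), strictly off the equator ([phi_potential_le],
    [psi_potential_le]).  For psi this reduces to
    1 / t^2 + 1 / (pi - t)^2 - cot^2 t <= 8 / pi^2, a midpoint convexity property
    of 1 / sin^2 t - 1 / t^2; for phi it is a numerical estimate near the pole
    and an expansion around the equator, where equality holds.

    Conclusion.  The two parts give Q(f) <= T_C(f), the difference being at least
    the integral of f^2 times a function that is positive off the equator.  If
    Q(f) = T_C(f) then f vanishes almost everywhere off the equator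
    ([zero_of_equality]).  The equator itself carries no mass of f^2: for
    g(t) = - atan(N t) the Hardy potential is N at t = 0 and at least - 8
    everywhere, so N times this mass is bounded independently of N
    ([equator_negligible]). *)

Set Implicit Arguments.
Unset Strict Implicit.
Unset Printing Implicit Defensive.

Import Order.TTheory GRing.Theory Num.Theory numFieldNormedType.Exports.

Local Open Scope classical_set_scope.
Local Open Scope ring_scope.

(** * Polynomial bounds for sin, cos and exp, and numerical bounds for pi and logarithms *)

Section taylor_bounds.
Variable R : realType.
Implicit Types x t : R.

Lemma le_of_is_derive_ge0 (F dF : R -> R) x : 0 <= x ->
  (forall t, is_derive t 1 F (dF t)) ->
  (forall t, 0 <= t <= x -> 0 <= dF t) -> F 0 <= F x.
Proof.
move=> x0 hF hdF.
have cF : {within `[0, x], continuous F}.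
  apply: continuous_subspaceT => t; apply: differentiable_continuous.
  by apply/derivable1_diffP; case: (hF t).
have [c c0x E] : exists2 c, c \in `[0, x] & F x - F 0 = dF c * (x - 0).
  by apply: MVT_segment => //.
rewrite -subr_ge0 E subr0 mulr_ge0 //; apply: hdF.
by move: c0x; rewrite in_itv.
Qed.

(** The Taylor bounds of sin and cos follow from one another by integration from
    0, starting from 1 - cos >= 0. *)
Lemma le_sin_id x : 0 <= x -> sin x <= x.
Proof.
move=> x0; rewrite -subr_ge0.
have h t : is_derive t 1 (fun t : R => t - sin t)
  (1 - cos t).
  exact: is_deriveB.
have := le_of_is_derive_ge0 x0 h; rewrite sin0 subrr; apply => t _.
by rewrite subr_ge0 cos_le1.
Qed.

Lemma cos_ge_deg2 x : 0 <= x -> 1 - x ^+ 2 / 2 <= cos x.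
Proof.
move=> x0; rewrite -subr_ge0.
have h t : is_derive t 1 (fun t : R => cos t - (1 - t ^+ 2 / 2))
  (t - sin t).
  by apply: is_derive_eq; rewrite /GRing.scale /=; lra.
have := le_of_is_derive_ge0 x0 h; rewrite cos0 expr0n /= mul0r subr0 subrr; apply => t /andP[t0 _].
by rewrite subr_ge0 le_sin_id.
Qed.

Lemma sin_ge_deg3 x : 0 <= x -> x - x ^+ 3 / 6 <= sin x.
Proof.
move=> x0; rewrite -subr_ge0.
have h t : is_derive t 1 (fun t : R => sin t - (t - t ^+ 3 / 6))
  (cos t - (1 - t ^+ 2 / 2)).
  by apply: is_derive_eq; rewrite /GRing.scale /=; lra.
have := le_of_is_derive_ge0 x0 h; rewrite sin0 expr0n /= mul0r subr0 subrr; apply => t /andP[t0 _].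
by rewrite subr_ge0 cos_ge_deg2.
Qed.

Lemma cos_le_deg4 x : 0 <= x -> cos x <= 1 - x ^+ 2 / 2 + x ^+ 4 / 24.
Proof.
move=> x0; rewrite -subr_ge0.
have h t : is_derive t 1 (fun t : R => (1 - t ^+ 2 / 2 + t ^+ 4 / 24) - cos t)
  (sin t - (t - t ^+ 3 / 6)).
  by apply: is_derive_eq; rewrite /GRing.scale /=; lra.
have := le_of_is_derive_ge0 x0 h; rewrite cos0 !expr0n /= !mul0r subr0 addr0 subrr; apply => t /andP[t0 _].
by rewrite subr_ge0 sin_ge_deg3.
Qed.

Lemma sin_le_deg5 x : 0 <= x -> sin x <= x - x ^+ 3 / 6 + x ^+ 5 / 120.
Proof.
move=> x0; rewrite -subr_ge0.
have h t : is_derive t 1 (fun t : R => (t - t ^+ 3 / 6 + t ^+ 5 / 120) - sin t)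
  ((1 - t ^+ 2 / 2 + t ^+ 4 / 24) - cos t).
  by apply: is_derive_eq; rewrite /GRing.scale /=; lra.
have := le_of_is_derive_ge0 x0 h; rewrite sin0 !expr0n /= !mul0r subr0 addr0 subrr; apply => t /andP[t0 _].
by rewrite subr_ge0 cos_le_deg4.
Qed.

Lemma mul_cos_le_sin x : 0 <= x <= pi -> x * cos x <= sin x.
Proof.
move=> /andP[x0 xpi]; rewrite -subr_ge0.
have h t : is_derive t 1 (fun t : R => sin t - t * cos t)
  (t * sin t).
  by apply: is_derive_eq; rewrite /GRing.scale /=; lra.
have := le_of_is_derive_ge0 x0 h; rewrite sin0 mul0r subrr; apply => t /andP[t0 tx].
by rewrite mulr_ge0 // sin_ge0_pi // t0 (le_trans tx).
Qed.

Lemma sin_sub_mul_cos_le x : 0 <= x -> sin x - x * cos x <= x ^+ 3 / 3.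
Proof.
move=> x0; rewrite -subr_ge0.
have h t : is_derive t 1 (fun t : R => t ^+ 3 / 3 - (sin t - t * cos t))
  (t * (t - sin t)).
  by apply: is_derive_eq; rewrite /GRing.scale /=; lra.
have := le_of_is_derive_ge0 x0 h; rewrite sin0 expr0n /= !mul0r !subrr; apply => t /andP[t0 _].
by rewrite mulr_ge0 // subr_ge0 le_sin_id.
Qed.

Lemma cos_ge_deg6 x : 0 <= x -> 1 - x ^+ 2 / 2 + x ^+ 4 / 24 - x ^+ 6 / 24 / 30 <= cos x.
Proof.
move=> x0; rewrite -subr_ge0.
have h t : is_derive t 1 (fun t : R => cos t - (1 - t ^+ 2 / 2 + t ^+ 4 / 24 - t ^+ 6 / 24 / 30))
  ((t - t ^+ 3 / 6 + t ^+ 5 / 120) - sin t).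
  by apply: is_derive_eq; rewrite /GRing.scale /=; field.
have := le_of_is_derive_ge0 x0 h; rewrite cos0 !expr0n /= !mul0r !subr0 addr0 subrr; apply => t /andP[t0 _].
by rewrite subr_ge0 sin_le_deg5.
Qed.

Lemma pi_gt_313 : 313 / 100 < pi :> R.
Proof.
(* 313/200 < pi/2 because cos is still positive there. *)
have h1 : 0 < cos (313 / 200 : R).
  by apply: lt_le_trans (cos_ge_deg6 _); lra.
have : (313 / 200 : R) < pi / 2.
  have p2 := @pi_ge2 R.
  by rewrite -ltr_cos ?in_itv /= ?cos_pihalf //; apply/andP; split; lra.
lra.
Qed.

Lemma pi_lt_315 : pi < 315 / 100 :> R.
Proof.
(* cos (63/40) < 0 by the duplication formula; the Taylor bound alone is too
   weak at 63/40, so it is used at half the argument. *)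
have h0 : cos (63 / 80 : R) <= 706 / 1000.
  by apply: le_trans (cos_le_deg4 _) _; lra.
have h0' : 0 <= cos (63 / 80 : R).
  by apply: le_trans (cos_ge_deg2 _); lra.
have h1 : cos (63 / 40 : R) < 0.
  rewrite (_ : 63 / 40 = 2 * (63 / 80)); last lra.
  rewrite mulr_natl cos_mulr2n.
  have : cos (63 / 80 : R) ^+ 2 <= (706 / 1000) ^+ 2.
    by rewrite lerXn2r // nnegrE; lra.
  lra.
have : pi / 2 < (63 / 40 : R).
  have p2 := @pi_ge2 R.
  by rewrite -ltr_cos ?in_itv /= ?cos_pihalf //; apply/andP; split; lra.
lra.
Qed.

Let expR_ge_deg2 x : 0 <= x -> 1 + x + x ^+ 2 / 2 <= expR x.
Proof.
move=> x0; rewrite -subr_ge0.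
have h t : is_derive t 1 (fun t : R => expR t - (1 + t + t ^+ 2 / 2))
  (expR t - (1 + t)).
  by apply: is_derive_eq; rewrite /GRing.scale /=; lra.
have := le_of_is_derive_ge0 x0 h; rewrite expR0 !expr0n /= !mul0r !addr0 subrr; apply => t /andP[t0 _].
by rewrite subr_ge0 expR_ge1Dx.
Qed.

Let expRN_le_deg2 x : 0 <= x -> expR (- x) <= 1 - x + x ^+ 2 / 2.
Proof.
move=> x0; rewrite -subr_ge0.
have h t : is_derive t 1 (fun t : R => 1 - t + t ^+ 2 / 2 - expR (- t))
  (expR (- t) - (1 - t)).
  by apply: is_derive_eq; rewrite /GRing.scale /=; lra.
have := le_of_is_derive_ge0 x0 h; rewrite oppr0 expR0 !expr0n /= !mul0r ?subr0 ?addr0 ?subr0 subrr; apply => t /andP[t0 _].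
by rewrite subr_ge0 expR_ge1Dx.
Qed.

Lemma expR_ge_deg3 x : 1 + x + x ^+ 2 / 2 + x ^+ 3 / 6 <= expR x.
Proof.
have [x0|/ltW x0] := leP 0 x; rewrite -subr_ge0.
  have h t : is_derive t 1 (fun t : R => expR t - (1 + t + t ^+ 2 / 2 + t ^+ 3 / 6))
    (expR t - (1 + t + t ^+ 2 / 2)).
    by apply: is_derive_eq; rewrite /GRing.scale /=; lra.
  have := le_of_is_derive_ge0 x0 h; rewrite expR0 !expr0n /= !mul0r !addr0 subrr; apply => t /andP[t0 _].
  by rewrite subr_ge0 expR_ge_deg2.
have h t : is_derive t 1 (fun t : R => expR (- t) - (1 - t + t ^+ 2 / 2 - t ^+ 3 / 6))
  (1 - t + t ^+ 2 / 2 - expR (- t)).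
  by apply: is_derive_eq; rewrite /GRing.scale /=; lra.
have x0' : 0 <= - x by rewrite oppr_ge0.
have := le_of_is_derive_ge0 x0' h.
rewrite oppr0 expR0 !expr0n /= !mul0r ?subr0 ?addr0 ?subr0 subrr opprK sqrrN exprNn.
rewrite (_ : (-1) ^+ 3 * x ^+ 3 / 6 = - (x ^+ 3 / 6)); last lra.
rewrite opprK; apply => t /andP[t0 _].
by rewrite subr_ge0 expRN_le_deg2.
Qed.

(** Squaring makes the cubic Taylor bound of exp, accurate near 0 only, usable at
    twice the argument. *)
Lemma expR_double_ge (a : R) x : 0 <= a -> a <= expR x -> a ^+ 2 <= expR (2 * x).
Proof.
by move=> a0 ax; rewrite expRM_natl lerXn2r // nnegrE (le_trans a0).
Qed.

Let ln_ge_of_expRN (a b x : R) : 0 < b -> 0 <= a -> a <= expR (- x) ->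
  1 <= b * a ^+ 2 -> 2 * x <= ln b.
Proof.
move=> b0 a0 /expR_double_ge => /(_ a0); rewrite mulrN expRN => h ab.
have e0 := expR_gt0 (2 * x).
rewrite -ler_expR (lnK b0).
have bV : b^-1 <= (expR (2 * x))^-1.
  apply: le_trans h; rewrite -[leLHS]mulr1 mulrC ler_pdivrMr //; lra.
by rewrite -(ler_pV2 _ _) ?inE ?unitfE ?gt_eqF.
Qed.

Lemma ln_pi_le : ln pi <= 116 / 100 :> R.
Proof.
have h : 178 / 100 <= expR (58 / 100 : R) by apply: le_trans (expR_ge_deg3 _); lra.
have := expR_double_ge _ h; rewrite (_ : 2 * _ = 116 / 100); last lra.
have p3 := pi_lt_315; have p0 := @pi_gt0 R.
move=> h2; rewrite -ler_expR lnK ?posrE //; apply: le_trans (ltW p3) _.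
by apply: le_trans (h2 _); lra.
Qed.

Lemma ln_pi_ge : 112 / 100 <= ln pi :> R.
Proof.
have h : 567 / 1000 <= expR (- (56 / 100) : R) by apply: le_trans (expR_ge_deg3 _); lra.
rewrite (_ : 112 / 100 = 2 * (56 / 100)); last lra.
apply: ln_ge_of_expRN h _; [exact: pi_gt0 | lra |].
have p3 := pi_gt_313; lra.
Qed.

Lemma ln2_ge : 68 / 100 <= ln 2 :> R.
Proof.
have h : 71 / 100 <= expR (- (34 / 100) : R) by apply: le_trans (expR_ge_deg3 _); lra.
rewrite (_ : 68 / 100 = 2 * (34 / 100)); last lra.
by apply: ln_ge_of_expRN h _; lra.
Qed.

Lemma ln2_le : ln 2 <= 7 / 10 :> R.
Proof.
rewrite -ler_expR lnK ?posrE //; apply: le_trans (expR_ge_deg3 _); lra.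
Qed.

End taylor_bounds.

(** * Midpoint convexity of 1 / sin^2 t - 1 / t^2 *)

Section csc_defect.
Variable R : realType.
Implicit Types t a b : R.

Definition csc_defect t : R := (sin t ^+ 2)^-1 - (t ^+ 2)^-1.

(** The duplication formula sin t = 2 sin (t/2) cos (t/2) turns into a recursion
    with contraction factor 1/4 and a source term that is itself convex. *)
Lemma csc_defect_half t : 0 < t < pi ->
  csc_defect t = (csc_defect (t / 2) + (cos (t / 2) ^+ 2)^-1) / 4.
Proof.
move=> /andP[t0 tpi]; have p0 := @pi_gt0 R.
have s0 : 0 < sin (t / 2) by apply: sin_gt0_pihalf; lra.
have c0 : 0 < cos (t / 2) by apply: cos_gt0_pihalf; lra.
rewrite /csc_defect.
have -> : sin t = 2 * sin (t / 2) * cos (t / 2).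
  by rewrite {1}(splitr t) sinD; ring.
have c2 := cos2sin2 (t / 2).
have s2 : 0 < 1 - sin (t / 2) ^+ 2 by rewrite -c2 exprn_gt0.
rewrite !exprMn c2; field.
by rewrite !gt_eqF.
Qed.

Lemma csc_defect_bounded t : 0 < t < pi / 2 -> 0 <= csc_defect t <= 1.
Proof.
move=> /andP[t0 tpi]; have p0 := @pi_gt0 R.
have s0 : 0 < sin t by apply: sin_gt0_pihalf; lra.
have c0 : 0 < cos t by apply: cos_gt0_pihalf; lra.
have st := le_sin_id (ltW t0).
have tc : t * cos t <= sin t by apply: mul_cos_le_sin; lra.
have cs := cos2Dsin2 t.
have st2 : 0 < sin t ^+ 2 * t ^+ 2 by rewrite mulr_gt0 // exprn_gt0.
have E : csc_defect t * (sin t ^+ 2 * t ^+ 2) = t ^+ 2 - sin t ^+ 2.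
  by rewrite /csc_defect; field; rewrite !gt_eqF.
apply/andP; split.
  by rewrite -(pmulr_lge0 _ st2) E; nra.
rewrite -(ler_pM2r st2) mul1r E.
have : (t * cos t) ^+ 2 <= sin t ^+ 2 by rewrite lerXn2r // nnegrE ltW ?mulr_gt0.
by rewrite exprMn cos2sin2; lra.
Qed.

(** cos is log-concave: cos a cos b = cos^2 m - sin^2 ((a - b)/2) <= cos^2 m for
    the midpoint m; the arithmetic-geometric inequality does the rest. *)
Lemma sec_sqr_midpoint_convex a b : - (pi / 2) < a < pi / 2 ->
  - (pi / 2) < b < pi / 2 ->
  2 * (cos ((a + b) / 2) ^+ 2)^-1 <= (cos a ^+ 2)^-1 + (cos b ^+ 2)^-1.
Proof.
move=> ha hb.
have ca : 0 < cos a by exact: cos_gt0_pihalf.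
have cb : 0 < cos b by exact: cos_gt0_pihalf.
have cm : 0 < cos ((a + b) / 2) by apply: cos_gt0_pihalf; lra.
have h : cos a * cos b <= cos ((a + b) / 2) ^+ 2.
  have prod u v : cos (u + v) * cos (u - v) <= cos u ^+ 2 :> R.
    rewrite cosD cosB; have := cos2Dsin2 u; have := cos2Dsin2 v.
    have := sqr_ge0 (sin v); nra.
  have := prod ((a + b) / 2) ((a - b) / 2).
  by congr (cos _ * cos _ <= _); lra.
have hV : (cos ((a + b) / 2) ^+ 2)^-1 <= (cos a)^-1 * (cos b)^-1.
  by rewrite -invfM lef_pV2 ?posrE ?mulr_gt0 ?exprn_gt0.
have := sqr_ge0 ((cos a)^-1 - (cos b)^-1); rewrite -!exprVn; nra.
Qed.

(** Along the recursion [csc_defect_half] the convexity defect is at least a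
    quarter of the defect at the halved arguments.  It is bounded below by -2
    at every level, hence by - 2 / 4^n for all n. *)
Lemma csc_defect_midpoint_convex a b : 0 < a < pi / 2 -> 0 < b < pi / 2 ->
  2 * csc_defect ((a + b) / 2) <= csc_defect a + csc_defect b.
Proof.
suff H n : forall a b, 0 < a < pi / 2 -> 0 < b < pi / 2 ->
    - 2 / 4 ^+ n <= csc_defect a + csc_defect b - 2 * csc_defect ((a + b) / 2).
  move=> ha hb; rewrite -subr_ge0; apply/ler_addgt0Pl => e e0.
  have [n] : exists n : nat, 2 / e < n%:R.
    by exists (Num.bound (2 / e)); apply: archi_boundP; rewrite divr_ge0 // ltW.
  move=> hn; have := H n _ _ ha hb.
  have n4 : (n%:R : R) <= 4 ^+ n.
    elim: (n) => [|k IH]; first by rewrite expr0.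
    have : (1 : R) <= 4 ^+ k by apply: exprn_ege1; lra.
    by rewrite exprS -(natr1 k); lra.
  have : 2 / 4 ^+ n <= e.
    rewrite ler_pdivrMr ?exprn_gt0 // mulrC -ler_pdivrMr //; lra.
  rewrite mulNr; lra.
elim: n => [|n IH] {}a {}b ha hb.
  rewrite expr0 divr1.
  have := csc_defect_bounded ha; have := csc_defect_bounded hb.
  have : 0 <= csc_defect ((a + b) / 2) <= 1 by apply: csc_defect_bounded; lra.
  lra.
have ha2 : 0 < a / 2 < pi / 2 by lra.
have hb2 : 0 < b / 2 < pi / 2 by lra.
have := IH _ _ ha2 hb2.
rewrite (csc_defect_half (t := a)); last lra.
rewrite (csc_defect_half (t := b)); last lra.
rewrite (csc_defect_half (t := (a + b) / 2)); last lra.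
have -> : a / 2 + b / 2 = (a + b) / 2 by lra.
have : 2 * (cos ((a / 2 + b / 2) / 2) ^+ 2)^-1 <=
   (cos (a / 2) ^+ 2)^-1 + (cos (b / 2) ^+ 2)^-1.
  by apply: sec_sqr_midpoint_convex; lra.
have -> : a / 2 + b / 2 = (a + b) / 2 by lra.
rewrite (exprS _ n) (invfM 4); lra.
Qed.

(** By [csc_defect_half] and sec (t/2) = csc ((pi - t)/2), the difference between
    1 / sin^2 t and 1 / t^2 + 1 / (pi - t)^2 is a quarter of the sum of the values of
    [csc_defect] at t/2 and (pi - t)/2, whose midpoint is always pi/4.  Equality
    holds at t = pi/2. *)
Lemma inv_sqr_sub_cot_le t : 0 < t < pi ->
  (t ^+ 2)^-1 + ((pi - t) ^+ 2)^-1 - (cos t / sin t) ^+ 2 <= 8 / pi ^+ 2.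
Proof.
move=> ht; have p0 := @pi_gt0 R.
have s0 : 0 < sin t by exact: sin_gt0_pi.
have -> : (cos t / sin t) ^+ 2 = (sin t ^+ 2)^-1 - 1.
  rewrite expr_div_n cos2sin2 mulrBl divff ?mul1r //.
  by rewrite gt_eqF // exprn_gt0.
have Et := csc_defect_half ht.
have Ea : (cos (t / 2) ^+ 2)^-1 = csc_defect ((pi - t) / 2) + 4 / (pi - t) ^+ 2.
  rewrite /csc_defect (_ : (pi - t) / 2 = pi / 2 - t / 2); last lra.
  rewrite sinB sin_pihalf cos_pihalf mul0r subr0 mul1r.
  rewrite (_ : pi / 2 - t / 2 = (pi - t) / 2); last lra.
  have pt0 : 0 < pi - t by lra.
  have c0 : 0 < cos (t / 2) by apply: cos_gt0_pihalf; lra.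
  by set u := pi - t in pt0 *; clearbody u; field; rewrite !gt_eqF.
have cvx : 2 * csc_defect ((t / 2 + (pi - t) / 2) / 2) <=
    csc_defect (t / 2) + csc_defect ((pi - t) / 2).
  by apply: csc_defect_midpoint_convex; lra.
have E4 : csc_defect ((t / 2 + (pi - t) / 2) / 2) = 2 - 16 / pi ^+ 2.
  rewrite (_ : (t / 2 + (pi - t) / 2) / 2 = pi / 4); last lra.
  have : cos (pi / 2) = 1 - 2 * sin (pi / 4) ^+ 2 :> R.
    rewrite (_ : pi / 2 = pi / 4 + pi / 4); last lra.
    by rewrite cosD -!expr2 cos2sin2; lra.
  rewrite cos_pihalf => e.
  have e2 : sin (pi / 4) ^+ 2 = 2^-1 :> R by lra.
  rewrite /csc_defect e2 invrK expr_div_n invf_div (_ : 4 ^+ 2 = 16) //; lra.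
rewrite Ea in Et.
have -> : (sin t ^+ 2)^-1 = csc_defect t + (t ^+ 2)^-1 by rewrite /csc_defect subrK.
rewrite E4 in cvx; rewrite Et; lra.
Qed.

End csc_defect.

(** * The weights phi and psi near the poles *)

Section polar_weights.
Variable R : realType.
Implicit Types t x y : R.
Local Notation c := (1 + ln pi : R).
Local Notation l := (1 + ln 2 : R).

Lemma phiE t : 0 < t -> phi t = c - ln t.
Proof.
move=> t0; rewrite /phi ln_div ?posrE ?mulr_gt0 ?pi_gt0 ?expR_gt0 //.
by rewrite lnM ?posrE ?pi_gt0 ?expR_gt0 // expRK (addrC (ln pi)).
Qed.

Lemma psiE t : 0 < sin t -> psi t = c - ln (sin t).
Proof. exact: phiE. Qed.

Lemma ln_le_sub1 x : 0 < x -> ln x <= x - 1.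
Proof.
by move=> x0; rewrite -{1}(subrK 1 x) addrC; apply: le_ln1Dx; lra.
Qed.

Lemma c_ge : 212 / 100 <= c. Proof. by have := @ln_pi_ge R; lra. Qed.
Lemma c_le : c <= 216 / 100. Proof. by have := @ln_pi_le R; lra. Qed.

Lemma psi_ge t : 0 < t < pi -> c <= psi t.
Proof.
move=> ht; rewrite psiE ?sin_gt0_pi //.
by have := @ln_le0 R _ (sin_le1 t); lra.
Qed.

Lemma psi_gt t : 0 < t < pi -> cos t != 0 -> c < psi t.
Proof.
move=> ht ct; rewrite psiE ?sin_gt0_pi // ltrBrDr gtrDl.
have s0 : 0 < sin t by exact: sin_gt0_pi.
apply: ln_lt0; rewrite s0 /= lt_neqAle sin_le1 andbT.
apply: contra ct => /eqP s1; rewrite -sqrf_eq0 cos2sin2 s1 expr1n subrr //.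
Qed.

Lemma psi_pi_sub t : psi (pi - t) = psi t.
Proof. by rewrite /psi sinB sinpi cospi mul0r sub0r mulN1r opprK. Qed.

(** As psi is symmetric about the equator it factors out of the left-hand side,
    and it is at least c. *)
Lemma rho_psi_potential_le t : 0 < t < pi ->
  (rho (@psi R) t ^+ 2)^-1 + (rho (@psi R) (pi - t) ^+ 2)^-1
    - (cos t / sin t / psi t) ^+ 2 <= 8 / (pi ^+ 2 * c ^+ 2).
Proof.
move=> ht; have := inv_sqr_sub_cot_le ht.
have psic := psi_ge ht; have cge := c_ge.
have psi0 : 0 < psi t by lra.
have hV : (psi t ^+ 2)^-1 <= (c ^+ 2)^-1.
  by rewrite lef_pV2 ?posrE ?exprn_gt0 ?lerXn2r ?nnegrE //; lra.
have psiV0 : 0 < (psi t ^+ 2)^-1 by rewrite invr_gt0 exprn_gt0.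
have p0 : 0 <= 8 / pi ^+ 2 :> R by rewrite divr_ge0 // sqr_ge0.
rewrite /rho psi_pi_sub => J.
have -> : ((t * psi t) ^+ 2)^-1 + (((pi - t) * psi t) ^+ 2)^-1 -
    (cos t / sin t / psi t) ^+ 2 =
  ((t ^+ 2)^-1 + ((pi - t) ^+ 2)^-1 - (cos t / sin t) ^+ 2) * (psi t ^+ 2)^-1.
  by rewrite -!exprVn !invfM; ring.
apply: (@le_trans _ _ (8 / pi ^+ 2 * (psi t ^+ 2)^-1)).
  by rewrite ler_pM2r.
rewrite [(pi ^+ 2 * _)^-1]invfM [leRHS]mulrA; exact: ler_wpM2l.
Qed.

(** The numerical core near the pole, with C = c, P = psi t, and u, g their
    inverses.  The constant 17/100 is a lower bound of - ln sin t for t <= 1,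
    127/1000 an upper bound of 1 / rho(pi - t)^2, and 278/1000 a lower bound of the
    value 2 / rho(pi/2)^2 = 8 / (pi (1 + ln 2))^2; the first summand is the bound
    of [polar_main]. *)
Lemma polar_margin (C g u P : R) : 212 / 100 <= C -> 0 < P ->
  C + 17 / 100 <= P -> C * u = 1 -> P * g = 1 ->
  (2 / 10 * u + 4 / 10) * (2 * u) * g + 127 / 1000 <
  278 / 1000 + (2 * u - 2 * g).
Proof.
move=> C1 P0 CP Cu Pg.
have u0 : 0 < u by nra.
have g0 : 0 < g by nra.
have u1 : u <= 472 / 1000 by nra.
have gu : g * (1 + 17 / 100 * u) <= u.
  have -> : 1 + 17 / 100 * u = (C + 17 / 100) * u by clear -Cu; lra.
  have : (C + 17 / 100) * g <= 1 by rewrite -[leRHS]Pg ler_wpM2r // ltW.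
  nra.
have K0 : 0 < 1 + 17 / 100 * u by lra.
suff : g * (2 + 4 / 10 * u ^+ 2 + 8 / 10 * u) < 151 / 1000 + 2 * u by lra.
rewrite -(ltr_pM2r K0) mulrAC.
apply: (@le_lt_trans _ _ (u * (2 + 4 / 10 * u ^+ 2 + 8 / 10 * u))).
  by apply: ler_wpM2r => //; nra.
have u2 : u ^+ 2 <= 223 / 1000 by nra.
have u3 : u ^+ 3 <= 106 / 1000 by rewrite exprS; nra.
nra.
Qed.

(** With F = phi t, P = psi t, k = t cot t and s = t^2, the left-hand side is t^2
    times 1 / rho(t)^2 - (cot t / psi t)^2.  The factor 1/F - k/P of
    this difference of squares is O(s) because P - F = ln (t / sin t) and 1 - k
    both are. *)
Lemma polar_main (C F P k s : R) : 0 < C -> C <= F -> F <= P ->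
  P - F <= s / 5 -> 0 <= k <= 1 -> 1 - k <= 4 / 10 * s -> 0 < s ->
  F^-1 ^+ 2 - (k * P^-1) ^+ 2 <=
  s * ((2 / 10 * C^-1 + 4 / 10) * (2 * C^-1) * P^-1).
Proof.
move=> C0 CF FP PF /andP[k0 k1] hk s0.
have F0 : 0 < F by lra.
have P0 : 0 < P by lra.
have FE : F * F^-1 = 1 by rewrite divff // gt_eqF.
have PE : P * P^-1 = 1 by rewrite divff // gt_eqF.
have f0 : 0 < F^-1 by rewrite invr_gt0.
have g0 : 0 < P^-1 by rewrite invr_gt0.
have fi : F^-1 <= C^-1 by rewrite lef_pV2 ?posrE.
have gf : P^-1 <= F^-1 by rewrite lef_pV2 ?posrE.
move: FE PE f0 g0 fi gf.
set f := F^-1; set g := P^-1; set u := C^-1 => FE PE f0 g0 fi gf.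
have d1 : f - k * g = (P - F + F * (1 - k)) * f * g.
  transitivity (f * (P * g) - k * g * (F * f)); last ring.
  by rewrite FE PE !mulr1.
have d2 : f - k * g <= s * (2 / 10 * f + 4 / 10) * g.
  rewrite d1 ler_pM2r //.
  apply: (@le_trans _ _ ((s / 5 + F * (4 / 10 * s)) * f)).
    by rewrite ler_pM2r // lerD // ler_pM2l.
  rewrite (_ : (s / 5 + F * (4 / 10 * s)) * f = s / 5 * f + 4 / 10 * s * (F * f)); last ring.
  by rewrite FE; lra.
have d0 : 0 <= f + k * g by nra.
have d3 : f + k * g <= 2 * u by nra.
rewrite subr_sqr.
apply: (@le_trans _ _ (s * (2 / 10 * f + 4 / 10) * g * (f + k * g))).
  by rewrite ler_wpM2r.
have a0 : 0 <= s * (2 / 10 * f + 4 / 10) * g.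
  by apply: mulr_ge0; [apply: mulr_ge0; lra | lra].
apply: (@le_trans _ _ (s * (2 / 10 * f + 4 / 10) * g * (2 * u))).
  by rewrite ler_wpM2l.
rewrite (_ : s * ((2 / 10 * u + 4 / 10) * (2 * u) * g) = s * (2 / 10 * u + 4 / 10) * g * (2 * u)); last ring.
have u0 : 0 <= 2 * u by lra.
rewrite ler_wpM2r // ler_pM2r // ler_pM2l //; lra.
Qed.

Lemma rho_phi_potential_lt_polar t : 0 < t <= 1 ->
  (rho (@phi R) t ^+ 2)^-1 + (rho (@phi R) (pi - t) ^+ 2)^-1
    - (cos t / sin t / psi t) ^+ 2
  < 8 / (pi ^+ 2 * l ^+ 2) + (2 / c - 2 / psi t).
Proof.
move=> /andP[t0 t1].
have p1 := @pi_gt_313 R; have p2 := @pi_lt_315 R.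
have s0 : 0 < sin t by apply: sin_gt0_pi; lra.
have s56 : 5 / 6 * t <= sin t.
  by have := sin_ge_deg3 (ltW t0); clear -t0 t1; nra.
have st := le_sin_id (ltW t0).
have F : phi t = c - ln t by apply: phiE.
have P : psi t = c - ln (sin t) by apply: psiE.
have D : psi t - phi t <= t ^+ 2 / 5.
  rewrite F P (_ : c - ln (sin t) - (c - ln t) = ln t - ln (sin t)); last ring.
  rewrite -ln_div ?posrE //; apply: le_trans (ln_le_sub1 _) _.
    by rewrite divr_gt0.
  rewrite lerBlDr ler_pdivrMr //; have := sin_ge_deg3 (ltW t0).
  by clear -t0 t1 s56; nra.
have phi_c : c <= phi t by rewrite F lerDl oppr_ge0 ln_le0.
have phi_psi : phi t <= psi t by rewrite F P lerB // ler_ln ?posrE.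
have psi_s : c + 17 / 100 <= psi t.
  rewrite P lerD2l lerNr -ler_expR lnK ?posrE //.
  apply: le_trans (expR_ge_deg3 _).
  apply: le_trans (sin_le_deg5 (ltW t0)) _.
  have : t ^+ 5 <= t ^+ 3 by apply: ler_wiXn2l; rewrite // ltW.
  have : t ^+ 3 = t * t * t by rewrite !exprS expr0 mulr1 mulrA.
  by clear -t0 t1; nra.
(* The antipodal term stays small: rho (pi - t) >= 281/100 when t <= 1. *)
have Ga : (rho (@phi R) (pi - t) ^+ 2)^-1 <= 127 / 1000.
  have a0 : 0 < pi - t by lra.
  have pE : pi * pi^-1 = 1 :> R by rewrite divff // gt_eqF //; lra.
  have pV : pi^-1 <= 32 / 100 :> R by clear -pE p1; nra.
  have ha : 1 + t / pi <= phi (pi - t).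
    rewrite phiE // (_ : ln (pi - t) = ln pi + ln ((pi - t) / pi)); last first.
      by rewrite ln_div ?posrE //; [ring | lra].
    have := @ln_le_sub1 ((pi - t) / pi); rewrite divr_gt0 //; last lra.
    move=> /(_ isT); rewrite mulrBl pE; lra.
  have : 281 / 100 <= rho (@phi R) (pi - t).
    rewrite /rho; apply: le_trans (_ : (pi - t) * (1 + t / pi) <= _); last by rewrite ler_pM2l.
    rewrite (_ : (pi - t) * (1 + t / pi) = pi - t + t * (pi * pi^-1) - t * t * pi^-1); last by rewrite mulrDr; ring.
    by rewrite pE; clear -p1 pV t0 t1; nra.
  set r := rho _ _ => hr.
  have r2 : 0 < r ^+ 2 by rewrite exprn_gt0 //; lra.
  rewrite -[leLHS]mul1r ler_pdivrMr //; clear -hr; nra.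
have Gm : 278 / 1000 <= 8 / (pi ^+ 2 * l ^+ 2).
  have l1 := @ln2_ge R; have l2 := @ln2_le R.
  have p0 : 0 < pi ^+ 2 * l ^+ 2.
    by rewrite mulr_gt0 ?exprn_gt0 ?pi_gt0 //; clear -l1; lra.
  rewrite ler_pdivlMr //.
  have : pi ^+ 2 <= (315 / 100) ^+ 2 :> R.
    by rewrite !expr2; apply: ler_pM; rewrite ?pi_ge0 // ltW.
  have : l ^+ 2 <= (17 / 10) ^+ 2.
    by rewrite lerXn2r ?nnegrE //; clear -l1 l2; lra.
  have : 0 < pi ^+ 2 :> R by rewrite exprn_gt0 ?pi_gt0.
  clear; nra.
pose k := t * (cos t / sin t).
have kE : k * sin t = t * cos t by rewrite /k -!mulrA mulVf ?mulr1 // gt_eqF.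
have k0 : 0 <= k <= 1.
  rewrite /k mulr_ge0 ?divr_ge0 ?(ltW t0) ?(ltW s0) //=; last first.
    by apply: cos_ge0_pihalf; lra.
  rewrite -(ler_pM2r s0) kE mul1r; apply: mul_cos_le_sin; lra.
have k1 : 1 - k <= 4 / 10 * t ^+ 2.
  rewrite -(ler_pM2r s0) mulrBl mul1r kE.
  have := sin_sub_mul_cos_le (ltW t0); clear -t0 t1 s56; nra.
have cge := c_ge.
have t2 : 0 < t ^+ 2 by rewrite exprn_gt0.
have psi0 : 0 < psi t by lra.
have c0 : 0 < c by lra.
have main := polar_main c0 phi_c phi_psi D k0 k1 t2.
have mar : _ := polar_margin cge psi0 psi_s (divff _) (divff _).
rewrite !gt_eqF // in mar; have {}mar := mar isT isT.
rewrite addrAC.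
apply: le_lt_trans (_ : (2 / 10 * c^-1 + 4 / 10) * (2 * c^-1) * (psi t)^-1 + 127 / 1000 < _).
  apply: lerD => //.
  rewrite -(ler_pM2l t2); apply: le_trans main.
  rewrite /k /rho -!exprVn !invfM le_eqVlt; apply/orP; left; apply/eqP.
  have tE : t * t^-1 = 1 by rewrite divff // gt_eqF.
  transitivity ((t * t^-1) ^+ 2 * (phi t)^-1 ^+ 2 - (t * (cos t / sin t) * (psi t)^-1) ^+ 2); first ring.
  by rewrite tE expr1n mul1r.
by apply: lt_le_trans mar _; rewrite lerD2r.
Qed.
End polar_weights.

(** * The weight phi near the equator *)

Section equatorial_estimates.
Variable R : realType.
Implicit Types t x y : R.

(** The exponential form is monotone: (1 - t) exp (t + t^2/2 + t^3/3) has derivative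
    - t^3 exp (...), the cubic being the truncated series of - ln (1 - t). *)
Lemma ln_1B_le y : 0 <= y < 1 -> y + y ^+ 2 / 2 + y ^+ 3 / 3 <= - ln (1 - y).
Proof.
move=> /andP[y0 y1].
pose w (t : R) := t + t ^+ 2 / 2 + t ^+ 3 / 3.
have h t : is_derive t 1 (fun t : R => - ((1 - t) * expR (w t))) (t ^+ 3 * expR (w t)).
  by rewrite /w; apply: is_derive_eq; rewrite /GRing.scale /=; lra.
have := le_of_is_derive_ge0 y0 h.
rewrite /w !expr0n /= !mul0r !addr0 subr0 expR0 mulr1 lerN2 => H.
have {}H : (1 - y) * expR (w y) <= 1.
  by apply: H => t /andP[t0 _]; rewrite mulr_ge0 ?expR_ge0 ?exprn_ge0.
rewrite -/(w y) lerNr -ler_expR lnK ?posrE ?subr_gt0 // expRN.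
by rewrite -[leRHS]mul1r ler_pdivlMr ?expR_gt0.
Qed.

Lemma ln_1D_le y : 0 <= y -> ln (1 + y) <= y - y ^+ 2 / 2 + y ^+ 3 / 3.
Proof.
move=> y0.
pose w (t : R) := t - t ^+ 2 / 2 + t ^+ 3 / 3.
have h t : is_derive t 1 (fun t : R => - ((1 + t) * expR (- w t))) (t ^+ 3 * expR (- w t)).
  by rewrite /w; apply: is_derive_eq; rewrite /GRing.scale /=; lra.
have := le_of_is_derive_ge0 y0 h.
rewrite /w !expr0n /= !mul0r subr0 !addr0 oppr0 expR0 mulr1 lerN2 => H.
have {}H : (1 + y) * expR (- w y) <= 1.
  by apply: H => t /andP[t0 _]; rewrite mulr_ge0 ?expR_ge0 ?exprn_ge0.
rewrite -/(w y) -ler_expR lnK ?posrE; last lra.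
by move: H; rewrite expRN ler_pdivrMr ?expR_gt0 // mul1r.
Qed.

(** Here L = 1 + ln 2, y is the relative distance to the equator, A = - ln (1 - y) and
    B = ln (1 + y), so that the two bases are rho_phi at the symmetric angles
    pi/2 (1 - y) and pi/2 (1 + y), divided by pi/2.  Their sum is at most 2 L and their
    product p is at least L^2 (1 - O(y^2)); the sum of the inverse squares
    is therefore at most (4 L^2 - 2 p) / p^2, which decreases in p. *)
Lemma equator_algebra (L A B y : R) : 168 / 100 <= L <= 17 / 10 ->
  0 < y -> y ^+ 2 <= 136 / 1000 ->
  y + y ^+ 2 / 2 + y ^+ 3 / 3 <= A -> B <= y - y ^+ 2 / 2 + y ^+ 3 / 3 ->
  (1 - y) * A <= y -> y <= (1 + y) * B ->
  ((1 - y) * (L + A)) ^- 2 + ((1 + y) * (L - B)) ^- 2 <=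
  (2 + 604 / 100 * y ^+ 2) / L ^+ 2.
Proof.
move=> /andP[L1 L2] y0 y2 hA hB hA1 hB1.
have L0 : 0 < L by clear -L1; lra.
have y1 : y < 1 by clear -y0 y2; nra.
have B1 : B < 1 by nra.
set r1 := (1 - y) * (L + A); set r2 := (1 + y) * (L - B).
have r10 : 0 < r1 by apply: mulr_gt0; nra.
have r20 : 0 < r2 by apply: mulr_gt0; nra.
have S : r1 + r2 <= 2 * L by rewrite /r1 /r2; lra.
have Q : L ^+ 2 + (L - 1) * y ^+ 2 - 5 / 12 * y ^+ 4 - y ^+ 6 / 9 <= (L + A) * (L - B).
  apply: (@le_trans _ _ ((L + y + y ^+ 2 / 2 + y ^+ 3 / 3) * (L - y + y ^+ 2 / 2 - y ^+ 3 / 3))).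
    by rewrite le_eqVlt; apply/orP; left; apply/eqP; field.
  apply: ler_pM; [nra | | lra | lra].
  have : y ^+ 3 <= y by rewrite exprS; nra.
  nra.
have u0 : 0 < y ^+ 2 by rewrite exprn_gt0.
have P : L ^+ 2 * (1 - 8125 / 1000 / 10 * y ^+ 2) <= r1 * r2.
  rewrite (_ : r1 * r2 = (1 - y ^+ 2) * ((L + A) * (L - B))); last by rewrite /r1 /r2; ring.
  have e1 : 0 < 1 - y ^+ 2 by lra.
  rewrite -(ler_pM2l e1) in Q.
  apply: le_trans _ Q.
  rewrite (_ : y ^+ 4 = y ^+ 2 * y ^+ 2); last ring.
  rewrite (_ : y ^+ 6 = y ^+ 2 * y ^+ 2 * y ^+ 2); last ring.
  move: u0 y2; clear -L1 L2; set u := y ^+ 2 => u0 y2.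
  have LL : 0 <= (L - 168 / 100) * (17 / 10 - L) by apply: mulr_ge0; lra.
  have main : 0 <= L - 1 - L ^+ 2 * (1875 / 1000 / 10) - u * (L - 1 + 5 / 12).
    by have : u * (L - 1 + 5 / 12) <= 136 / 1000 * (L - 1 + 5 / 12);
      [rewrite ler_wpM2r //; lra | nra].
  have rest : 0 <= u ^+ 3 * (5 / 12 - 9^-1) + u ^+ 4 / 9.
    have := exprn_gt0 3 u0; have := exprn_gt0 4 u0; lra.
  by have := mulr_ge0 (ltW u0) main; lra.
set K := 2 + _; set z0 := 1 - _ in P.
have z00 : 0 < z0 by rewrite /z0; clear -y2; lra.
(* K bounds (4 - 2 z) / z^2 at z = z0, the lower bound of p / L^2. *)
have Kz : 4 <= 2 * z0 + K * z0 ^+ 2.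
  rewrite /K /z0; move: u0 y2; clear; set u := y ^+ 2 => u0 y2.
  have : u * u <= 136 / 1000 * u by rewrite ler_wpM2r // ltW.
  have : 0 <= u ^+ 3 by rewrite exprn_ge0 // ltW.
  lra.
have p0 : 0 < r1 * r2 by rewrite mulr_gt0.
have L20 : 0 < L ^+ 2 by rewrite exprn_gt0.
have K0 : 0 < K by rewrite /K; clear -u0; lra.
rewrite (_ : r1 ^- 2 + r2 ^- 2 = (r1 ^+ 2 + r2 ^+ 2) / (r1 * r2) ^+ 2); last first.
  by field; rewrite !gt_eqF.
rewrite ler_pdivrMr ?exprn_gt0 // mulrAC ler_pdivlMr //.
set p := r1 * r2 in P p0 *.
have SS : r1 ^+ 2 + r2 ^+ 2 <= 4 * L ^+ 2 - 2 * p.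
  rewrite /p; have : (r1 + r2) ^+ 2 <= (2 * L) ^+ 2.
    by rewrite lerXn2r ?nnegrE //; clear -r10 r20 L0; lra.
  by clear; lra.
apply: (@le_trans _ _ ((4 * L ^+ 2 - 2 * p) * L ^+ 2)); first by rewrite ler_pM2r.
have Lz0 : 0 < L ^+ 2 * z0 by rewrite mulr_gt0.
have p2 : (L ^+ 2 * z0) ^+ 2 <= p ^+ 2 by rewrite lerXn2r ?nnegrE // ltW.
have h1 : K * (L ^+ 2 * z0) ^+ 2 <= K * p ^+ 2 by rewrite ler_pM2l.
have h2 : (L ^+ 2 * z0) * L ^+ 2 <= p * L ^+ 2 by rewrite ler_pM2r.
have h3 : L ^+ 2 * L ^+ 2 * 4 <= L ^+ 2 * L ^+ 2 * (2 * z0 + K * z0 ^+ 2).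
  by rewrite ler_pM2l // mulr_gt0.
move: h1 h2 h3; clear; move: (L ^+ 2) => M h1 h2 h3; lra.
Qed.

(** Here C = c, x is the angular distance to the equator and s = - ln cos x, so
    that C + s = psi; the right-hand side is the gain of the Hardy
    potential over its value at the equator, with tan x weakened to x. *)
Lemma equator_margin (C s x : R) : 212 / 100 <= C <= 216 / 100 ->
  0 < x <= 575 / 1000 -> x ^+ 2 / 2 - x ^+ 4 / 24 <= s -> s <= 199 / 1000 ->
  358 / 1000 * x ^+ 2 < 2 / C - 2 / (C + s) + x ^+ 2 / (C + s) ^+ 2.
Proof.
move=> /andP[C1 C2] /andP[x0 x1] s1 s2.
have x2 : 0 < x ^+ 2 by rewrite exprn_gt0.
have x2b : x ^+ 2 <= 331 / 1000.
  by clear -x0 x1; nra.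
have s3 : 486 / 1000 * x ^+ 2 <= s.
  apply: le_trans s1; rewrite (_ : x ^+ 4 = x ^+ 2 * x ^+ 2); last ring.
  have : x ^+ 2 * x ^+ 2 <= 331 / 1000 * x ^+ 2 by rewrite ler_pM2r.
  lra.
have C0 : 0 < C by lra.
have P0 : 0 < C + s by lra.
have Pb : C + s <= 236 / 100 by lra.
have e : 2 / C - 2 / (C + s) = 2 * s / (C * (C + s)) by field; rewrite !gt_eqF.
have h1 : 19 / 100 * x ^+ 2 <= 2 / C - 2 / (C + s).
  rewrite e ler_pdivlMr ?mulr_gt0 //.
  have : C * (C + s) <= 216 / 100 * (236 / 100).
    by apply: ler_pM => //; exact: ltW.
  move=> CP; apply: (@le_trans _ _ (19 / 100 * x ^+ 2 * (216 / 100 * (236 / 100)))).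
    by rewrite ler_wpM2l //; clear -x2; lra.
  by clear -x2 s3; lra.
have h2 : 179 / 1000 * x ^+ 2 <= x ^+ 2 / (C + s) ^+ 2.
  rewrite ler_pdivlMr ?exprn_gt0 //.
  have : (C + s) ^+ 2 <= (236 / 100) ^+ 2.
    by rewrite !expr2; apply: ler_pM => //; exact: ltW.
  have a0 : 0 <= 179 / 1000 * x ^+ 2 by clear -x2; lra.
  move=> /(ler_wpM2l a0) /le_trans; apply.
  by clear -x2; move: (x ^+ 2) x2 => u x2; lra.
by clear -h1 h2 x2; lra.
Qed.
End equatorial_estimates.

Section potential_comparison.
Variable R : realType.
Implicit Types t x y : R.
Local Notation c := (1 + ln pi : R).
Local Notation l := (1 + ln 2 : R).

Lemma rho_phi_scale y : -1 < y ->
  rho (@phi R) (pi / 2 * (1 + y)) = pi / 2 * ((1 + y) * (l - ln (1 + y))).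
Proof.
move=> y1; have p0 := @pi_gt0 R.
have y0 : 0 < 1 + y by lra.
have m0 : 0 < pi / 2 :> R by rewrite divr_gt0.
rewrite /rho phiE ?mulr_gt0 // lnM ?posrE // ln_div ?posrE //.
rewrite -mulrA; congr (_ * (_ * _)); ring.
Qed.

(** With x = pi/2 - t and y = x / (pi/2), the left-hand potential exceeds its
    value at the equator by at most 0.358 x^2 ([equator_algebra]), which is less
    than what the Hardy potential gains ([equator_margin]). *)
Lemma rho_phi_potential_lt_equator t : 1 <= t < pi / 2 ->
  (rho (@phi R) t ^+ 2)^-1 + (rho (@phi R) (pi - t) ^+ 2)^-1
    - (cos t / sin t / psi t) ^+ 2
  < 8 / (pi ^+ 2 * l ^+ 2) + (2 / c - 2 / psi t).
Proof.
move=> /andP[t1 tm].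
have p1 := @pi_gt_313 R; have p2 := @pi_lt_315 R.
have l1 := @ln2_ge R; have l2 := @ln2_le R.
have c1 := c_ge R; have c2 := c_le R.
set M : R := pi / 2.
have M1 : 1565 / 1000 <= M by rewrite /M; lra.
have M2 : M <= 1575 / 1000 by rewrite /M; lra.
pose x := M - t.
have x0 : 0 < x by rewrite /x /M; lra.
have x1 : x <= 575 / 1000 by rewrite /x; lra.
have cosx : cos t = sin x by rewrite /x sinB sin_pihalf cos_pihalf; ring.
have sinx : sin t = cos x by rewrite /x cosB sin_pihalf cos_pihalf; ring.
clear p1 p2.
have M0 : 0 < M by clear -M1; lra.
pose y := x / M.
have xE : x = M * y by rewrite /y mulrC divfK // gt_eqF.
have y0 : 0 < y by rewrite divr_gt0.
have tE : t = M * (1 + - y) by rewrite mulrDr mulrN -xE /x; ring.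
have aE : pi - t = M * (1 + y).
  by rewrite mulrDr -xE /x {1}(splitr pi) -/M; ring.
clearbody y x.
have x2 : x ^+ 2 <= 331 / 1000 by clear -x0 x1; nra.
have MM : 2449 / 1000 <= M ^+ 2 by clear -M1; nra.
have y2 : y ^+ 2 <= 136 / 1000.
  have : x ^+ 2 = M ^+ 2 * y ^+ 2 by rewrite xE; ring.
  have := exprn_gt0 2 y0; clear -x2 MM; nra.
have y1 : y < 1 by clear -y0 y2; nra.
have N1 : -1 < - y by rewrite ltrN2.
have Y1 : -1 < y by apply: lt_trans y0; exact: ltrN10.
have pot : (rho (@phi R) t ^+ 2)^-1 + (rho (@phi R) (pi - t) ^+ 2)^-1 <=
   (M ^+ 2)^-1 * ((2 + 604 / 100 * y ^+ 2) / l ^+ 2).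
  rewrite aE tE !rho_phi_scale // -/M ![(M * _) ^+ 2]exprMn.
  rewrite ![(M ^+ 2 * _)^-1]invfM -mulrDr ler_pM2l ?invr_gt0 ?exprn_gt0 //.
  apply: equator_algebra => //.
  - by clear -l1 l2; apply/andP; split; lra.
  - by apply: ln_1B_le; rewrite ltW.
  - by apply: ln_1D_le; rewrite ltW.
  - have z0 : 0 < 1 - y by rewrite subr_gt0.
    rewrite -lnV ?posrE //; have := @ln_le_sub1 R (1 - y)^-1.
    rewrite invr_gt0 => /(_ z0) h; have := ler_wpM2l (ltW z0) h.
    by rewrite mulrBr mulfV ?gt_eqF //; clear; lra.
  - have z0 : 0 < 1 + y by clear -y0; lra.
    have := @ln_le_sub1 R (1 + y)^-1; rewrite invr_gt0 => /(_ z0) h.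
    have := ler_wpM2l (ltW z0) h.
    by rewrite lnV ?posrE // mulrBr mulfV ?gt_eqF //; clear; lra.
have l0 : 0 < l by clear -l1; lra.
have pot2 : (M ^+ 2)^-1 * ((2 + 604 / 100 * y ^+ 2) / l ^+ 2) <=
    8 / (pi ^+ 2 * l ^+ 2) + 358 / 1000 * x ^+ 2.
  have -> : 8 / (pi ^+ 2 * l ^+ 2) = (M ^+ 2)^-1 * (2 / l ^+ 2).
    rewrite /M; have := @pi_gt0 R; clear -l0; move: (1 + ln 2) l0 (pi : R).
    by move=> L L0 p p0; field; rewrite !gt_eqF.
  rewrite [(_ + _) / _]mulrDl mulrDr lerD2l xE [(M * y) ^+ 2]exprMn.
  have B1 : 282 / 100 <= l ^+ 2 by clear -l1; nra.
  have u0 : 0 < y ^+ 2 by rewrite exprn_gt0.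
  move: (M ^+ 2) MM (l ^+ 2) B1 (y ^+ 2) u0; clear.
  move=> a a1 b b1 u u0.
  have a0 : 0 < a by lra.
  have b0 : 0 < b by lra.
  rewrite (_ : a^-1 * _ = 604 / 100 / (a * b) * u); last by field; rewrite !gt_eqF.
  rewrite mulrA ler_pM2r // ler_pdivrMr ?mulr_gt0 //.
  have aa : 599 / 100 <= a * a by clear -a1; nra.
  have : 599 / 100 * (282 / 100) <= a * a * b by clear -aa b1; nra.
  by clear; lra.
have cosx0 : 1 - x ^+ 2 / 2 <= cos x by apply: cos_ge_deg2; exact: ltW.
have cosx1 : 121 / 145 <= cos x by clear -cosx0 x2; lra.
have cx0 : 0 < cos x by clear -cosx1; lra.
have PE : psi t = c + - ln (cos x) by rewrite psiE sinx.
have s1 : x ^+ 2 / 2 - x ^+ 4 / 24 <= - ln (cos x).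
  have := ln_le_sub1 cx0; have := cos_le_deg4 (ltW x0); clear; lra.
have s2 : - ln (cos x) <= 199 / 1000.
  rewrite -lnV ?posrE //; apply: le_trans (ln_le_sub1 _) _; first by rewrite invr_gt0.
  rewrite lerBlDr -[leLHS]mul1r ler_pdivrMr //; clear -cosx1; lra.
have mar : 358 / 1000 * x ^+ 2 < 2 / c - 2 / psi t + x ^+ 2 / psi t ^+ 2.
  by rewrite PE; apply: equator_margin => //; apply/andP; split.
have psi0 : 0 < psi t.
  rewrite PE; have := ln_le0 (cos_le1 x); clear -c1; lra.
have cot : x ^+ 2 / psi t ^+ 2 <= (cos t / sin t / psi t) ^+ 2.
  rewrite cosx sinx [leRHS]expr_div_n ler_pM2r ?invr_gt0 ?exprn_gt0 //.
  have : x <= sin x / cos x.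
    rewrite ler_pdivlMr //; apply: mul_cos_le_sin; rewrite ltW //=.
    by have := @pi_ge2 R; clear -x1; lra.
  by move=> h; rewrite lerXn2r // nnegrE; [exact: ltW | apply: le_trans h; exact: ltW].
move: pot pot2 mar cot; clear; lra.
Qed.

(** The right-hand side W is four times C / 4 plus the potential of the
    ground state psi^(1/2).  Equality at the equator is what fixes
    the constant 8 / (pi (1 + ln 2))^2 = 2 / rho(pi/2)^2. *)
Lemma phi_potential_le t : 0 < t < pi ->
  let V := (rho (@phi R) t ^+ 2)^-1 + (rho (@phi R) (pi - t) ^+ 2)^-1 in
  let W := 8 / (pi ^+ 2 * l ^+ 2) + (2 / c - 2 / psi t) + (cos t / sin t / psi t) ^+ 2 in
  V <= W /\ (cos t != 0 -> V < W).
Proof.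
move=> /andP[t0 tpi] /=.
have strict s : 0 < s < pi / 2 ->
   (rho (@phi R) s ^+ 2)^-1 + (rho (@phi R) (pi - s) ^+ 2)^-1 <
   8 / (pi ^+ 2 * l ^+ 2) + (2 / c - 2 / psi s) + (cos s / sin s / psi s) ^+ 2.
  move=> /andP[s0 sm]; rewrite -ltrBlDr; have [s1|s1] := leP s 1.
    by apply: rho_phi_potential_lt_polar; rewrite s0.
  by apply: rho_phi_potential_lt_equator; rewrite ltW.
have [tm|tm|tm] := ltgtP t (pi / 2).
- by split=> [|_]; [apply: ltW|]; apply: strict; rewrite t0.
- have := strict (pi - t); rewrite subKr psi_pi_sub.
  have -> : cos (pi - t) = - cos t.
    by rewrite cosB sinpi cospi mul0r addr0 mulN1r.
  have -> : sin (pi - t) = sin t.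
    by rewrite sinB sinpi cospi mul0r sub0r mulN1r opprK.
  have h : 0 < pi - t < pi / 2 by clear -tm tpi; apply/andP; split; lra.
  move=> /(_ h); rewrite !mulNr sqrrN addrC => H.
  by split=> [|_]; [apply: ltW|].
- rewrite tm cos_pihalf eqxx; split=> //.
  have pE : pi - pi / 2 = pi / 2 :> R by rewrite {1}(splitr pi) addrK.
  have -> : psi (pi / 2) = c by rewrite psiE sin_pihalf // ln1 subr0.
  rewrite pE !mul0r expr0n addr0 subrr addr0 -mulr2n.
  have := @rho_phi_scale 0; rewrite addr0 mulr1 mul1r ln1 subr0 => ->; last by rewrite ltrN10.
  rewrite le_eqVlt; apply/orP; left; apply/eqP.
  have l0 : 0 < l by have := @ln2_ge R; clear; lra.
  have := @pi_gt0 R; move: l l0 (pi : R); clear => L L0 p p0.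
  by field; rewrite !gt_eqF.
Qed.

Lemma psi_potential_le t : 0 < t < pi ->
  let V := (rho (@psi R) t ^+ 2)^-1 + (rho (@psi R) (pi - t) ^+ 2)^-1 in
  let W := 8 / (pi ^+ 2 * c ^+ 2) + (2 / c - 2 / psi t) + (cos t / sin t / psi t) ^+ 2 in
  V <= W /\ (cos t != 0 -> V < W).
Proof.
move=> ht /=; have := rho_psi_potential_le ht; rewrite lerBlDr => H.
have c1 := c_ge R; have c0 : 0 < c by clear -c1; lra.
have h1 := psi_ge ht; have p0 := lt_le_trans c0 h1.
split=> [|ct]; [apply: le_trans H _ | apply: le_lt_trans H _].
  by rewrite lerD2r lerDl subr_ge0 ler_pM2l // lef_pV2 ?posrE.
by rewrite ltrD2r ltrDl subr_gt0 ltr_pM2l // ltf_pV2 ?posrE //; exact: psi_gt.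
Qed.
End potential_comparison.

(** * Integration on the sphere in spherical coordinates *)

Section density.
Local Open Scope ereal_scope.
Context d1 d2 (X : measurableType d1) (Y : measurableType d2) (R : realType).
Variables (mu : {measure set X -> \bar R}) (nu : {measure set Y -> \bar R}).
Variables (h : X -> Y) (D : set X) (g : X -> R).
Hypothesis mh : measurable_fun setT h.
Hypothesis mD : measurable D.
Hypothesis mg : measurable_fun D g.
Let mgE : measurable_fun D (EFin \o g).
Proof. exact/measurable_EFinP. Qed.
Hypothesis g0 : forall x, D x -> (0 <= g x)%R.
Hypothesis nuE : forall A, measurable A -> nu A = \int[mu]_(x in D `&` h @^-1` A) (g x)%:E.

Import HBNNSimple.

(** The change of variables formula for a measure nu that is the image under h of
    the measure with density g on D: it is the definition of nu for indicators,
    and follows for nonnegative functions by linearity and monotone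
    convergence. *)
Lemma ge0_integral_density (f : Y -> \bar R) : measurable_fun setT f ->
  (forall y, 0 <= f y) ->
  \int[nu]_y f y = \int[mu]_(x in D) (f (h x) * (g x)%:E).
Proof.
move=> mf f0.
pose f_ := nnsfun_approx measurableT mf.
have mhA (A : set Y) : measurable A -> measurable (h @^-1` A).
  by move=> mA; rewrite -[X in measurable X]setTI; exact: mh.
have f_cvg y : EFin (f_ n y) @[n --> \oo] --> f y.
  exact: (cvg_nnsfun_approx measurableT mf (fun y _ => f0 y) Logic.I).
have nd y : {homo (fun n => (f_ n y)%:E) : m n / (m <= n)%N >-> m <= n}.
  by move=> m n mn; rewrite lee_fin; exact/lefP/nd_nnsfun_approx.
transitivity (limn (fun n => \int[nu]_x (f_ n x)%:E)).
  rewrite -monotone_convergence//.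
  - by apply: eq_integral => y _; apply/esym/cvg_lim.
  - by move=> n; exact/measurable_EFinP/measurable_funP.
  - by move=> n y _; rewrite lee_fin.
have mfh n : measurable_fun D (fun x => (f_ n (h x))%:E).
  apply/measurable_EFinP/measurable_funTS.
  by apply: measurableT_comp => //; exact: measurable_funP.
transitivity (limn (fun n => \int[mu]_(x in D) ((f_ n (h x))%:E * (g x)%:E))); last first.
  rewrite -monotone_convergence//.
  - apply: eq_integral => x xD; apply/cvg_lim => //.
    have Dx : D x by rewrite inE in xD.
    by apply: cvgeZr.
  - by move=> n; exact: emeasurable_funM.
  - by move=> n y Dy; rewrite mule_ge0 ?lee_fin ?g0 ?lee_fin.
  - by move=> x Dx m n mn; rewrite lee_wpmul2r ?lee_fin ?g0 //; exact: nd.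
congr (limn _); apply/funext => n.
transitivity (\sum_(k \in range (f_ n)) \int[nu]_x (k * \1_(f_ n @^-1` [set k]) x)%:E).
  under eq_integral do rewrite fimfunE -fsumEFin//.
  rewrite ge0_integral_fsum//.
  - by move=> y; exact/measurable_EFinP/measurable_funM.
  - by move=> y x _; rewrite nnfun_muleindic_ge0.
transitivity (\sum_(k \in range (f_ n)) \int[mu]_(x in D)
    ((k * \1_(f_ n @^-1` [set k]) (h x))%:E * (g x)%:E)); last first.
  rewrite -ge0_integral_fsum//.
  - apply: eq_integral => x xD; rewrite -ge0_mule_fsuml => [|y]; last exact: nnfun_muleindic_ge0.
    by rewrite fsumEFin // -(fimfunE _ (h x)).
  - move=> y; apply: emeasurable_funM => //; apply/measurable_EFinP/measurable_funTS.
    by apply: measurable_funM => //; apply: measurableT_comp.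
  - by move=> m x Dx; apply: mule_ge0; [exact: nnfun_muleindic_ge0 | rewrite lee_fin g0].
apply: eq_fsbigr => r; rewrite inE => -[y _ <-]; set A := _ @^-1` _.
have mA : measurable A by rewrite /A -[X in measurable X]setTI; exact: (measurable_funP (f_ n)) _ (measurable_set1 _).
rewrite integralZl_indic_nnsfun // integral_indic // setIT nuE //.
under [RHS]eq_integral do rewrite EFinM -muleA.
rewrite ge0_integralZl //; last 3 first.
- apply: emeasurable_funM => //; apply/measurable_EFinP/measurable_funTS.
  by apply: measurableT_comp.
- by move=> x Dx; rewrite mule_ge0 ?lee_fin ?g0 ?lee_fin.
- by rewrite lee_fin.
congr (_ * _); rewrite integral_mkcondr; apply: eq_integral => x _.
by rewrite epatch_indic muleC.
Qed.
End density.

Section measurable_open.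

(** The sigma-algebra of a product is generated by measurable rectangles; a
    countable base made of measurable sets is what makes open sets measurable
    for it. *)
Definition countable_base_in (T : topologicalType) (M : set (set T)) :=
  exists B : nat -> set T, (forall n, M (B n)) /\
    forall x U, nbhs x U -> exists2 n, B n x & B n `<=` U.

Lemma countable_base_in_prod (T1 T2 : topologicalType) (M1 : set (set T1))
    (M2 : set (set T2)) (M : set (set (T1 * T2))) :
  (forall A B, M1 A -> M2 B -> M (A `*` B)) ->
  countable_base_in M1 -> countable_base_in M2 -> countable_base_in M.
Proof.
move=> MX [B1 [MB1 HB1]] [B2 [MB2 HB2]].
pose ij n := odflt (0%N, 0%N) (unpickle n : option (nat * nat)).
exists (fun n => B1 (ij n).1 `*` B2 (ij n).2); split=> [n|[x y] U]; first exact: MX.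
case=> -[V1 V2] /= [/HB1[i B1x B1V] /HB2[j B2y B2V]] VU.
exists (pickle (i, j)); rewrite /ij pickleK //= => -[a b] [/= ? ?].
by apply: VU; split; [exact: B1V | exact: B2V].
Qed.

Lemma countable_base_in_real (R : realType) :
  @countable_base_in R (@measurable _ R).
Proof.
pose qn n := odflt (0%Q, 0%N) (unpickle n : option (rat * nat)).
exists (fun n => ball (ratr (qn n).1 : R) (qn n).2.+1%:R^-1); split=> [n|x U].
  exact: measurable_ball.
move=> /nbhs_ballP[e /= e0 eU].
have [n ne] : exists n : nat, 2 * n.+1%:R^-1 < e.
  exists (Num.bound (2 / e)); rewrite ltr_pdivrMr // -ltr_pdivrMl // mulrC.
  apply: (@lt_trans _ _ (Num.bound (2 / e))%:R); last by rewrite ltr_nat.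
  by apply: archi_boundP; rewrite divr_ge0 // ltW.
have n0 : 0 < n.+1%:R^-1 :> R by rewrite invr_gt0.
have /rat_in_itvoo[q] : x - n.+1%:R^-1 < x + n.+1%:R^-1.
  by rewrite ltrBlDr -addrA ltrDl addr_gt0.
rewrite in_itv /= ltrBlDr => /andP[q1 q2].
(* A ball with rational centre q near x and radius 1/(n+1) below e/2. *)
exists (pickle (q, n)); rewrite /qn pickleK /=.
  by rewrite /ball /= ltr_distlC ltrBlDr q1 q2.
move=> y; rewrite /ball /= => yq; apply: eU; rewrite /ball /=.
rewrite (_ : x - y = (x - ratr q) + (ratr q - y)); last by rewrite addrA subrK.
apply: le_lt_trans (ler_normD _ _) _; apply: lt_trans ne.
rewrite mulr_natl mulr2n; apply: ltrD yq.
by rewrite ltr_distl ltrBlDr q2 q1.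
Qed.

Lemma open_in_of_base (T : topologicalType) (M : set (set T)) (A : set T) :
  M set0 -> (forall F : nat -> set T, (forall n, M (F n)) -> M (\bigcup_n F n)) ->
  countable_base_in M -> open A -> M A.
Proof.
move=> M0 MU [B [MB HB]] oA.
have -> : A = \bigcup_n (if `[< B n `<=` A >] then B n else set0).
  apply/seteqP; split=> [x Ax|x [n _]].
    have [n Bx BA] := HB x A (open_nbhs_nbhs (conj oA Ax)).
    by exists n => //; case: asboolP.
  by case: asboolP => // BA /BA.
by apply: MU => n; case: asboolP.
Qed.

Variable R : realType.

Lemma open_measurable_plane (A : set (R * R)) : open A -> measurable A.
Proof.
apply: open_in_of_base; [exact: measurable0 | exact: bigcupT_measurable |].
by apply: countable_base_in_prod (@countable_base_in_real R) (@countable_base_in_real R) => B C; exact: measurableX.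
Qed.

Lemma open_measurable_space (A : set (R3 R)) : open A -> measurable A.
Proof.
apply: open_in_of_base; [exact: measurable0 | exact: bigcupT_measurable |].
apply: countable_base_in_prod (@countable_base_in_real R); last first.
  by apply: countable_base_in_prod (@countable_base_in_real R) (@countable_base_in_real R) => B C; exact: measurableX.
by move=> B C; exact: measurableX.
Qed.

Lemma continuous_measurable_plane (f : R * R -> R) :
  continuous f -> measurable_fun setT f.
Proof.
move=> cf; apply: (measurability _ (RGenOpens.measurableE R)).
move=> _ [_ [a [b ->] <-]]; rewrite setTI; apply: open_measurable_plane.
by move/continuousP: cf; apply; exact: interval_open.
Qed.

Lemma open_continuous_measurable_space (U : set (R3 R)) (f : R3 R -> R) :
  open U -> (forall x, U x -> {for x, continuous f}) -> measurable_fun U f.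
Proof.
move=> oU cf; apply: (measurability _ (RGenOpens.measurableE R)).
move=> _ [_ [a [b ->] <-]]; apply: open_measurable_space.
rewrite openE => x [Ux fx]; rewrite /interior.
apply: filterI; first exact: open_nbhs_nbhs.
by apply: (cf x Ux); apply: open_nbhs_nbhs; split=> //; exact: interval_open.
Qed.

End measurable_open.

Section sphere_coordinates.
Variable R : realType.
Local Notation leb2 := ((@lebesgue_measure R \x @lebesgue_measure R)%E).

Lemma dot_sph (z : R * R) : dot (sph z) (sph z) = 1.
Proof.
rewrite /dot /sph /=; have := cos2Dsin2 z.1; have := cos2Dsin2 z.2; nra.
Qed.

Lemma sphereP (x : R3 R) : sphere x <-> dot x x = 1.
Proof.
rewrite /sphere /= /enorm; split=> [h|->]; last exact: sqrtr1.
have h0 : 0 <= dot x x by rewrite /dot -!expr2 !addr_ge0 ?sqr_ge0.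
by rewrite -(sqr_sqrtr h0) h expr1n.
Qed.

Lemma sphere_sph (z : R * R) : sphere (sph z).
Proof. by apply/sphereP; exact: dot_sph. Qed.

Lemma measurable_dot (F G : R3 R -> R3 R) :
  measurable_fun setT F -> measurable_fun setT G ->
  measurable_fun setT (fun x => dot (F x) (G x)).
Proof.
move=> mF mG.
have m1 (H : R3 R -> R3 R) : measurable_fun setT H -> measurable_fun setT (fun x => (H x).1.1).
  by move=> mH; do 2 (apply: measurableT_comp; first exact: measurable_fst).
have m2 (H : R3 R -> R3 R) : measurable_fun setT H -> measurable_fun setT (fun x => (H x).1.2).
  move=> mH; apply: measurableT_comp; first exact: measurable_snd.
  by apply: measurableT_comp; first exact: measurable_fst.
have m3 (H : R3 R -> R3 R) : measurable_fun setT H -> measurable_fun setT (fun x => (H x).2).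
  by move=> mH; apply: measurableT_comp; first exact: measurable_snd.
apply: measurable_funD; [apply: measurable_funD |]; apply: measurable_funM.
- exact: m1.
- exact: m1.
- exact: m2.
- exact: m2.
- exact: m3.
- exact: m3.
Qed.

Lemma measurable_sphere : measurable (@sphere R).
Proof.
rewrite (_ : sphere = (fun x : R3 R => dot x x) @^-1` [set 1]); last first.
  by apply/seteqP; split=> x /sphereP.
by rewrite -[X in measurable X]setTI; apply: measurable_dot.
Qed.

Lemma ge0_integral_sigma (F : R3 R -> \bar R) : measurable_fun sphere F ->
  (forall x, sphere x -> (0 <= F x)%E) ->
  (\int[sigma]_(x in sphere) F x =
   \int[leb2]_(z in @sph_dom R) (F (sph z) * (sin z.1)%:E))%E.
Proof.
move=> mF F0; rewrite integral_mkcond.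
have msin : measurable_fun (@sph_dom R) (fun z : R * R => sin z.1).
  apply: measurable_funTS; apply: measurableT_comp measurable_fst.
  by apply: continuous_measurable_fun; exact: continuous_sin.
rewrite (@ge0_integral_density _ _ _ _ R leb2 sigma (@sph R) (@sph_dom R) (fun z => sin z.1)).
- apply: eq_integral => z _; rewrite patchE ifT //.
  by rewrite inE; exact: sphere_sph.
- exact: measurable_sph.
- exact: measurable_sph_dom.
- exact: msin.
- by move=> z [/= z1 _]; exact: sin_ge0_pi.
- by [].
- by apply/(measurable_restrictT _ measurable_sphere).
- by move=> x; rewrite patchE; case: ifPn => //; rewrite inE; exact: F0.
Qed.

End sphere_coordinates.

(** * Smooth functions on the sphere and integration over the coordinate rectangle *)

Section smooth_functions.
Variable R : realType.
Implicit Types (u : R3 R -> R) (x v p : R3 R) (z : R * R).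

Lemma sphere_neq0 x : sphere x -> x != 0.
Proof.
move=> /sphereP; apply: contra_eqN => /eqP ->; rewrite /dot /= !mulr0 !addr0.
by rewrite eq_sym oner_neq0.
Qed.

Lemma homext_sphere u x : sphere x -> homext u x = u x.
Proof. by rewrite /sphere /= /homext => ->; rewrite invr1 scale1r. Qed.

Lemma smooth_differentiable u x : smooth_sphere u -> x != 0 ->
  differentiable (homext u) x.
Proof. by move=> su x0; exact: (su [::]). Qed.

Lemma smooth_derive_differentiable u v x : smooth_sphere u -> x != 0 ->
  differentiable (fun y => 'D_v (homext u) y) x.
Proof. by move=> su x0; exact: (su [:: v]). Qed.

(** The Frechet derivative is linear and [grad] lists its values on the basis. *)
Lemma derive_grad u x v : smooth_sphere u -> x != 0 ->
  'D_v (homext u) x = dot (grad u x) v.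
Proof.
move=> su x0; have dH := smooth_differentiable su x0.
rewrite /dot /grad /= !deriveE //.
set e1 := ((1, 0, 0) : R3 R); set e2 := ((0, 1, 0) : R3 R).
set e3 := ((0, 0, 1) : R3 R).
have vE : v = v.1.1 *: e1 + v.1.2 *: e2 + v.2 *: e3.
  case: v => -[a b] c.
  rewrite -[RHS]/(a * 1 + b * 0 + c * 0, a * 0 + b * 1 + c * 0,
                  a * 0 + b * 0 + c * 1).
  by rewrite !mulr1 !mulr0 !addr0 !add0r.
rewrite {1}vE !linearD !linearZ.
rewrite -[LHS]/(v.1.1 * 'd (homext u) x e1 + v.1.2 * 'd (homext u) x e2
  + v.2 * 'd (homext u) x e3).
by congr (_ + _ + _); exact: mulrC.
Qed.

Lemma smooth_continuous u x : smooth_sphere u -> x != 0 ->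
  {for x, continuous (homext u)}.
Proof. by move=> su x0; apply: differentiable_continuous; exact: smooth_differentiable. Qed.

(** The chain rule along a curve given by its three coordinates, as needed for
    the meridians and parallels of the sphere. *)
Lemma is_derive_comp_curve (H : R3 R -> R) (a b c : R -> R) (da db dc t : R) :
  differentiable H (a t, b t, c t) ->
  is_derive t 1 a da -> is_derive t 1 b db -> is_derive t 1 c dc ->
  is_derive t 1 (fun s => H (a s, b s, c s)) ('D_(da, db, dc) H (a t, b t, c t)).
Proof.
move=> dH [da1 da2] [db1 db2] [dc1 dc2].
have Da := (derivable1_diffP a t).1 da1.
have Db := (derivable1_diffP b t).1 db1.
have Dc := (derivable1_diffP c t).1 dc1.
have Dab : differentiable (fun s => (a s, b s)) t by exact: differentiable_pair.
have Dabc : differentiable (fun s => (a s, b s, c s)) t by exact: differentiable_pair.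
have DH : differentiable (H \o (fun s => (a s, b s, c s))) t by exact: differentiable_comp.
split; first exact: (derivable1_diffP _ _).2 DH.
rewrite (deriveE _ dH) (deriveE _ DH) (diff_comp Dabc dH) /=.
rewrite (diff_pair Dab Dc) /= (diff_pair Da Db) /=.
have ea : 'd a t 1 = da by rewrite -da2 deriveE.
have eb : 'd b t 1 = db by rewrite -db2 deriveE.
have ec : 'd c t 1 = dc by rewrite -dc2 deriveE.
by congr ('d H _ (_, _, _)).
Qed.

End smooth_functions.

Section rectangle.
Variable R : realType.

Lemma is_derive_continuous (f : R -> R) (df t : R) : is_derive t (1 : R) f df ->
  {for t, continuous f}.
Proof.
by case=> h _; apply: differentiable_continuous; apply/derivable1_diffP.
Qed.

Local Notation leb := (@lebesgue_measure R).
Local Notation leb2 := ((@lebesgue_measure R \x @lebesgue_measure R)%E).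
Implicit Types D : R * R -> R.

Lemma continuous_slice1 D y : continuous D -> continuous (fun x => D (x, y)).
Proof.
move=> cD x; apply: (@continuous_comp _ _ _ (fun s => (s, y)) D); last exact: cD.
exact: (cvg_pair (@cvg_id _ _) (cvg_cst y)).
Qed.

Lemma continuous_slice2 D x : continuous D -> continuous (fun y => D (x, y)).
Proof.
move=> cD y; apply: (@continuous_comp _ _ _ (fun s => (x, s)) D); last exact: cD.
exact: (cvg_pair (cvg_cst x) (@cvg_id _ _)).
Qed.

Lemma sph_dom_finite : (leb2 (@sph_dom R) < +oo)%E.
Proof.
rewrite /sph_dom product_measure1E; [|exact: measurable_itv..].
have itv_lty (a b : R) : (leb `[a, b] < +oo)%E.
  by rewrite lebesgue_measure_itv /=; case: ifPn => _; rewrite -?EFinB ltry.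
by apply: lte_mul_pinfty; [exact: measure_ge0 | rewrite ge0_fin_numE ?measure_ge0 ?itv_lty | exact: itv_lty].
Qed.

Lemma continuous_integrable_rect D : continuous D ->
  leb2.-integrable (@sph_dom R) (EFin \o D).
Proof.
move=> cD; apply: measurable_bounded_integrable.
- exact: measurable_sph_dom.
- exact: sph_dom_finite.
- by apply: measurable_funTS; exact: continuous_measurable_plane.
have /compact_bounded[M [_ mrt]] : compact (D @` (@sph_dom R)).
  apply: continuous_compact; first exact: continuous_subspaceT.
  by apply: compact_setX; exact: segment_compact.
by exists M; split; rewrite ?num_real // => ? ? ? ?; exact: mrt.
Qed.

Lemma integral_rect_eq0_1 D : continuous D ->
  (forall y, \int[leb]_(x in `[0%R, pi]) (D (x, y))%:E = 0)%E ->
  (\int[leb2]_(z in @sph_dom R) (D z)%:E = 0)%E.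
Proof.
move=> cD D0; rewrite integral_mkcond -integral21_prod_meas1; last first.
  apply/(integrable_mkcond _ _).1; first exact: measurable_sph_dom.
  exact: continuous_integrable_rect.
apply: integral0_eq => y _.
have [yI|yI] := pselect (y \in `[0, 2 * pi]).
  rewrite /fubini_G -[RHS](D0 y) [RHS]integral_mkcond; apply: eq_integral => x _.
  rewrite !patchE /=; congr (if _ then _ else _).
  by apply/idP/idP; rewrite !inE; [case | move=> ?; split].
rewrite /fubini_G; apply: integral0_eq => x _; rewrite patchE ifF //.
by apply/negP; rewrite inE => -[_ /= h]; apply: yI.
Qed.

Lemma integral_rect_eq0_2 D : continuous D ->
  (forall x, \int[leb]_(y in `[0%R, (2 * pi)%R]) (D (x, y))%:E = 0)%E ->
  (\int[leb2]_(z in @sph_dom R) (D z)%:E = 0)%E.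
Proof.
move=> cD D0; rewrite integral_mkcond -integral12_prod_meas1; last first.
  apply/(integrable_mkcond _ _).1; first exact: measurable_sph_dom.
  exact: continuous_integrable_rect.
apply: integral0_eq => x _.
have [xI|xI] := pselect (x \in `[0, pi]).
  rewrite /fubini_F -[RHS](D0 x) [RHS]integral_mkcond; apply: eq_integral => y _.
  rewrite !patchE /=; congr (if _ then _ else _).
  by apply/idP/idP; rewrite !inE; [case | move=> ?; split].
rewrite /fubini_F; apply: integral0_eq => y _; rewrite patchE ifF //.
by apply/negP; rewrite inE => -[/= h _]; apply: xI.
Qed.

Lemma integral_is_derive (F D : R -> R) (a b : R) : a < b -> continuous D ->
  (forall t : R, is_derive t (1 : R) F (D t)) ->
  (\int[leb]_(x in `[a, b]) (D x)%:E = (F b - F a)%:E)%E.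
Proof.
move=> ab cD dF.
have cF : continuous F.
  by move=> t; exact: is_derive_continuous (dF t).
rewrite EFinB; apply: continuous_FTC2 => //.
- exact: continuous_subspaceT.
- split; first by move=> t _; case: (dF t).
  + by apply: cvg_at_right_filter; exact: cF.
  + by apply: cvg_at_left_filter; exact: cF.
- by move=> t _; rewrite derive1E; exact: derive_val.
Qed.

End rectangle.

(** * The divergence theorem and the Hardy inequality for smooth functions *)

Lemma dot_sphere_le1 (R : realType) (x p : R3 R) : sphere x -> sphere p ->
  -1 <= dot x p <= 1.
Proof.
move=> /sphereP hx /sphereP hp.
have := sqr_ge0 (x.1.1 - p.1.1); have := sqr_ge0 (x.1.2 - p.1.2).
have := sqr_ge0 (x.2 - p.2).
have := sqr_ge0 (x.1.1 + p.1.1); have := sqr_ge0 (x.1.2 + p.1.2).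
have := sqr_ge0 (x.2 + p.2).
move: hx hp; rewrite /dot => hx hp *; apply/andP; split; lra.
Qed.

Lemma dotC (R : realType) (x y : R3 R) : dot x y = dot y x.
Proof. by rewrite /dot; ring. Qed.

Lemma sqr_enorm (R : realType) (y : R3 R) : enorm y ^+ 2 = dot y y.
Proof. by rewrite /enorm sqr_sqrtr // /dot -!expr2 !addr_ge0 ?sqr_ge0. Qed.

Section sphere_measurability.
Variable R : realType.

Lemma measurable_continuous_sphere (f : R3 R -> R) :
  (forall x, x != 0 -> {for x, continuous f}) -> measurable_fun sphere f.
Proof.
move=> cf.
have o0 : open [set x : R3 R | x != 0].
  rewrite (_ : [set x | _] = ~` [set 0]); last first.
    by apply/seteqP; split=> x /=; [move/eqP | move=> h; apply/eqP].
  exact/closed_openC/accessible_closed_set1/hausdorff_accessible/norm_hausdorff.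
have h : measurable_fun [set x : R3 R | x != 0] f.
  exact: open_continuous_measurable_space.
apply: (measurable_funS _ _ h); first exact: open_measurable_space.
by move=> x; exact: sphere_neq0.
Qed.

Lemma measurable_smooth_sphere (u : R3 R -> R) : smooth_sphere u ->
  measurable_fun sphere u.
Proof.
move=> su; apply: (eq_measurable_fun (homext u)).
  by move=> x; rewrite inE => /(homext_sphere u).
by apply: measurable_continuous_sphere => x; exact: smooth_continuous.
Qed.

Lemma measurable_grad_sphere (u : R3 R -> R) (v : R3 R) : smooth_sphere u ->
  measurable_fun sphere (fun x => 'D_v (homext u) x).
Proof.
move=> su; apply: measurable_continuous_sphere => x x0.
by apply: differentiable_continuous; exact: smooth_derive_differentiable.
Qed.

Lemma measurable_dotl (p : R3 R) : measurable_fun setT (fun x => dot x p).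
Proof. exact: measurable_dot. Qed.

Lemma measurable_sphere_comp_dot (p : R3 R) (h : R -> R) : sphere p ->
  (forall t : R, -1 <= t <= 1 -> {for t, continuous h}) ->
  measurable_fun sphere (fun x => h (dot x p)).
Proof.
move=> sp ch; pose I : set R := `[-1, 1]%classic.
have mh : measurable_fun I h.
  apply: subspace_continuous_measurable_fun; first exact: measurable_itv.
  apply: continuous_in_subspaceT => t; rewrite inE => tI; apply: ch.
  by move: tI; rewrite /I /= in_itv.
apply: (measurable_comp (F := I)) => //.
- exact: measurable_itv.
- by move=> _ [x sx <-]; rewrite /I /= in_itv /= dot_sphere_le1.
- by apply: measurable_funTS; exact: measurable_dotl.
Qed.

Lemma measurable_sqr_enorm (G : R3 R -> R3 R) :
  measurable_fun sphere (fun x => (G x).1.1) ->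
  measurable_fun sphere (fun x => (G x).1.2) ->
  measurable_fun sphere (fun x => (G x).2) ->
  measurable_fun sphere (fun x => enorm (G x) ^+ 2).
Proof.
move=> m1 m2 m3.
rewrite (_ : (fun x => _) = (fun x => dot (G x) (G x))); last first.
  by apply/funext => x; exact: sqr_enorm.
by apply: measurable_funD; [apply: measurable_funD |]; exact: measurable_funM.
Qed.

End sphere_measurability.

Section divergence.
Variables (R : realType) (p : R3 R) (u : R3 R -> R) (g dg : R -> R).
Hypothesis hp : sphere p.
Hypothesis su : smooth_sphere u.
Hypothesis hg : forall t : R, -1 <= t <= 1 -> is_derive t (1 : R) g (dg t).
Hypothesis cdg : forall t : R, -1 <= t <= 1 -> {for t, continuous dg}.
Local Notation leb := (@lebesgue_measure R).
Local Notation leb2 := ((@lebesgue_measure R \x @lebesgue_measure R)%E).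
Implicit Types z : R * R.

(* The unit tangent vectors along meridians and parallels; with sph z they form
   an orthonormal frame. *)
Let eth z : R3 R := (cos z.1 * cos z.2, cos z.1 * sin z.2, - sin z.1).
Let eph z : R3 R := (- sin z.2, cos z.2, 0).
Let w z := dot (sph z) p.
Let U z := homext u (sph z).
Let G z := grad u (sph z).
Let m z := dot (eph z) p.
Let wt z := dot (eth z) p.

Let cM (f h : R * R -> R) : continuous f -> continuous h -> continuous (fun z => f z * h z).
Proof. by move=> cf ch z; apply: cvgM; [exact: cf | exact: ch]. Qed.
Let cA (f h : R * R -> R) : continuous f -> continuous h -> continuous (fun z => f z + h z).
Proof. by move=> cf ch z; apply: cvgD; [exact: cf | exact: ch]. Qed.
Let cN (f : R * R -> R) : continuous f -> continuous (fun z => - f z).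
Proof. by move=> cf z; apply: cvgN; exact: cf. Qed.
Let cC (k : R) : continuous (fun _ : R * R => k).
Proof. by move=> z; exact: cvg_cst. Qed.
Let ceq (f h : R * R -> R) : f =1 h -> continuous f -> continuous h.
Proof. by move=> /funext ->. Qed.
Let c1 : continuous (fun z : R * R => z.1).
Proof. by move=> [a b]; exact: (@cvg_fst _ _ (nbhs a) (nbhs b)). Qed.
Let c2 : continuous (fun z : R * R => z.2).
Proof. by move=> [a b]; exact: (@cvg_snd _ _ (nbhs a) (nbhs b)). Qed.
Let cs1 : continuous (fun z : R * R => sin z.1).
Proof. by move=> z; apply: continuous_comp; [exact: c1 | exact: continuous_sin]. Qed.
Let cs2 : continuous (fun z : R * R => sin z.2).
Proof. by move=> z; apply: continuous_comp; [exact: c2 | exact: continuous_sin]. Qed.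
Let cc1 : continuous (fun z : R * R => cos z.1).
Proof. by move=> z; apply: continuous_comp; [exact: c1 | exact: continuous_cos]. Qed.
Let cc2 : continuous (fun z : R * R => cos z.2).
Proof. by move=> z; apply: continuous_comp; [exact: c2 | exact: continuous_cos]. Qed.

Let csph : continuous (@sph R).
Proof.
have cpair (V W : topologicalType) (f : R * R -> V) (h : R * R -> W) :
    continuous f -> continuous h -> continuous (fun z => (f z, h z)).
  by move=> cf ch z; exact: cvg_pair (cf z) (ch z).
exact: (cpair _ _ _ _ (cpair _ _ _ _ (cM cs1 cc2) (cM cs1 cs2)) cc1).
Qed.

Let sph0 z : sph z != 0. Proof. exact: sphere_neq0 (sphere_sph z). Qed.

Let cU : continuous U.
Proof.
move=> z; apply: (@continuous_comp _ _ _ (@sph R) (homext u)); first exact: csph.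
exact: smooth_continuous.
Qed.

Let cG v : continuous (fun z => dot (G z) v).
Proof.
move=> z; rewrite /G.
have -> : (fun z => dot (grad u (sph z)) v) = (fun y => 'D_v (homext u) y) \o @sph R.
  by apply/funext => y /=; rewrite derive_grad.
apply: continuous_comp; first exact: csph.
by apply: differentiable_continuous; exact: smooth_derive_differentiable.
Qed.

Let cGi : [/\ continuous (fun z => (G z).1.1), continuous (fun z => (G z).1.2)
  & continuous (fun z => (G z).2)].
Proof.
split.
- have := @cG (1, 0, 0); apply: ceq => z.
  rewrite /dot; move: (G z) => -[[a b] c] /=; by rewrite !mulr0 !addr0 mulr1.
- have := @cG (0, 1, 0); apply: ceq => z.
  rewrite /dot; move: (G z) => -[[a b] c] /=; by rewrite !mulr0 !addr0 add0r mulr1.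
- have := @cG (0, 0, 1); apply: ceq => z.
  rewrite /dot; move: (G z) => -[[a b] c] /=; by rewrite !mulr0 !add0r mulr1.
Qed.

Let w1 z : -1 <= w z <= 1.
Proof. exact: dot_sphere_le1 (sphere_sph z) hp. Qed.

Let cw : continuous w.
Proof.
refine (cA (cA (cM (cM cs1 cc2) (@cC p.1.1)) (cM (cM cs1 cs2) (@cC p.1.2)))
  (cM cc1 (@cC p.2))).
Qed.

Let cgw : continuous (fun z => g (w z)).
Proof.
move=> z; apply: continuous_comp; first exact: cw.
exact: is_derive_continuous (hg (w1 z)).
Qed.

Let cdgw : continuous (fun z => dg (w z)).
Proof. by move=> z; apply: continuous_comp; [exact: cw | exact: cdg]. Qed.

Let cm : continuous m.
Proof.
refine (cA (cA (cM (cN cs2) (@cC p.1.1)) (cM cc2 (@cC p.1.2)))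
  (cM (@cC 0) (@cC p.2))).
Qed.

Let cwt : continuous wt.
Proof.
refine (cA (cA (cM (cM cc1 cc2) (@cC p.1.1)) (cM (cM cc1 cs2) (@cC p.1.2)))
  (cM (cN cs1) (@cC p.2))).
Qed.

Let dU1 z : is_derive z.1 (1 : R) (fun s => U (s, z.2)) (dot (G z) (eth z)).
Proof.
rewrite /U /G -derive_grad //; case: z => t q /=.
apply: (@is_derive_comp_curve _ _ (fun s => sin s * cos q) (fun s => sin s * sin q) (fun s => cos s)).
- exact: smooth_differentiable (sph0 (t, q)).
- by apply: is_derive_eq; rewrite /GRing.scale /=; ring.
- by apply: is_derive_eq; rewrite /GRing.scale /=; ring.
Qed.

Let dU2 z : is_derive z.2 (1 : R) (fun s => U (z.1, s)) (sin z.1 * dot (G z) (eph z)).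
Proof.
have -> : sin z.1 * dot (G z) (eph z) =
    dot (G z) (sin z.1 * - sin z.2, sin z.1 * cos z.2, 0).
  by rewrite /dot; move: (G z) => -[[a b] d] /=; ring.
rewrite /U /G -derive_grad //; case: z => t q /=.
apply: (@is_derive_comp_curve _ _ (fun s => sin t * cos s) (fun s => sin t * sin s) (fun s => cos t)).
- exact: smooth_differentiable (sph0 (t, q)).
Qed.

Let dw1 z : is_derive z.1 (1 : R) (fun s => w (s, z.2)) (wt z).
Proof.
rewrite /w /wt /dot /sph /eth /=.
by apply: is_derive_eq; rewrite /GRing.scale /=; ring.
Qed.

Let dw2 z : is_derive z.2 (1 : R) (fun s => w (z.1, s)) (sin z.1 * m z).
Proof.
rewrite /w /m /dot /sph /eph /=.
by apply: is_derive_eq; rewrite /GRing.scale /=; ring.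
Qed.

Let dwt z : is_derive z.1 (1 : R) (fun s => wt (s, z.2)) (- w z).
Proof.
rewrite /w /wt /dot /sph /eth /=.
by apply: is_derive_eq; rewrite /GRing.scale /=; ring.
Qed.

Let mp z := - (cos z.2 * p.1.1 + sin z.2 * p.1.2).

Let dm z : is_derive z.2 (1 : R) (fun s => m (z.1, s)) (mp z).
Proof.
rewrite /m /mp /dot /eph /=.
by apply: is_derive_eq; rewrite /GRing.scale /=; ring.
Qed.

Let dgw1 z : is_derive z.1 (1 : R) (fun s => g (w (s, z.2))) (dg (w z) * wt z).
Proof.
have h1 := dw1 z.
have h2 : is_derive ((fun s => w (s, z.2)) z.1) (1 : R) g (dg (w z)).
  by rewrite /= -surjective_pairing; exact: hg (w1 z).
exact: (@is_derive1_comp _ g (fun s => w (s, z.2)) z.1 _ _ h2 h1).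
Qed.

Let dgw2 z : is_derive z.2 (1 : R) (fun s => g (w (z.1, s))) (dg (w z) * (sin z.1 * m z)).
Proof.
have h1 := dw2 z.
have h2 : is_derive ((fun s => w (z.1, s)) z.2) (1 : R) g (dg (w z)).
  by rewrite /= -surjective_pairing; exact: hg (w1 z).
exact: (@is_derive1_comp _ g (fun s => w (z.1, s)) z.2 _ _ h2 h1).
Qed.

(* With P = u^2 g(w), the field P (p - w x) has components P wt and P m in the
   frame, so that sin theta times its divergence is d_theta F1 + d_phi F2. *)
Let F1 z := sin z.1 * (U z ^+ 2 * g (w z) * wt z).
Let D1 z := cos z.1 * (U z ^+ 2 * g (w z) * wt z) +
  sin z.1 * ((2 * U z * dot (G z) (eth z) * g (w z) + U z ^+ 2 * (dg (w z) * wt z)) * wt z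
     - U z ^+ 2 * g (w z) * w z).
Let F2 z := U z ^+ 2 * g (w z) * m z.
Let D2 z := (2 * U z * (sin z.1 * dot (G z) (eph z)) * g (w z)
     + U z ^+ 2 * (dg (w z) * (sin z.1 * m z))) * m z + U z ^+ 2 * g (w z) * mp z.

Let dF1 z : is_derive z.1 (1 : R) (fun s => F1 (s, z.2)) (D1 z).
Proof.
have := dU1 z; have h2 := dgw1 z; have h3 := dwt z.
rewrite /F1 /D1; move: (dot (G z) (eth z)) => k h1.
apply: is_derive_eq; rewrite /GRing.scale /= -?surjective_pairing; ring.
Qed.

Let dF2 z : is_derive z.2 (1 : R) (fun s => F2 (z.1, s)) (D2 z).
Proof.
have := dU2 z; have h2 := dgw2 z; have h3 := dm z.
rewrite /F2 /D2; move: (dot (G z) (eph z)) => k h1.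
apply: is_derive_eq; rewrite /GRing.scale /= -?surjective_pairing; ring.
Qed.

Let cGe1 : continuous (fun z => dot (G z) (eth z)).
Proof.
have [h1 h2 h3] := cGi.
refine (cA (cA (cM h1 (cM cc1 cc2)) (cM h2 (cM cc1 cs2))) (cM h3 (cN cs1))).
Qed.

Let cGe2 : continuous (fun z => dot (G z) (eph z)).
Proof.
have [h1 h2 h3] := cGi.
refine (cA (cA (cM h1 (cN cs2)) (cM h2 cc2)) (cM h3 (@cC 0))).
Qed.

Let cP : continuous (fun z => U z ^+ 2 * g (w z)).
Proof. refine (cM (cM cU cU) cgw). Qed.

Let cD1 : continuous D1.
Proof.
refine (cA (cM cc1 (cM cP cwt)) (cM cs1 (cA (cM (cA
  (cM (cM (cM (@cC 2) cU) cGe1) cgw) (cM (cM cU cU) (cM cdgw cwt))) cwt)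
  (cN (cM cP cw))))).
Qed.

Let cD2 : continuous D2.
Proof.
refine (cA (cM (cA (cM (cM (cM (@cC 2) cU) (cM cs1 cGe2)) cgw)
  (cM (cM cU cU) (cM cdgw (cM cs1 cm)))) cm) (cM cP
  (cN (cA (cM cc2 (@cC p.1.1)) (cM cs2 (@cC p.1.2)))))).
Qed.

(* The boundary terms vanish because sin theta does at both poles. *)
Let intD1 : (\int[leb2]_(z in @sph_dom R) (D1 z)%:E = 0)%E.
Proof.
apply: integral_rect_eq0_1 => // y.
have h t : is_derive t (1 : R) (fun s => F1 (s, y)) (D1 (t, y)) := dF1 (t, y).
have -> := integral_is_derive (pi_gt0 R) (@continuous_slice1 _ D1 y cD1) h.
by rewrite /F1 /= sin0 sinpi !mul0r subrr.
Qed.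

(* The boundary terms cancel by periodicity in phi. *)
Let intD2 : (\int[leb2]_(z in @sph_dom R) (D2 z)%:E = 0)%E.
Proof.
apply: integral_rect_eq0_2 => // x.
have h t : is_derive t (1 : R) (fun s => F2 (x, s)) (D2 (x, t)) := dF2 (x, t).
have pi2 : 0 < 2 * pi :> R by rewrite mulr_gt0 // pi_gt0.
have -> := integral_is_derive pi2 (@continuous_slice2 _ D2 x cD2) h.
by rewrite /F2 /U /w /m /sph /eph /= mulr_natl sin2pi cos2pi sin0 cos0 subrr.
Qed.

Let frame z (q : R3 R) :
  dot q p = dot q (sph z) * w z + dot q (eth z) * wt z + dot q (eph z) * m z.
Proof.
rewrite /w /wt /m /dot /sph /eth /eph /=.
have A := cos2Dsin2 z.1; have C := cos2Dsin2 z.2.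
move: (cos z.1) (sin z.1) (cos z.2) (sin z.2) A C => a b c d A C.
case: q => -[q1 q2] q3; case: (p) => -[p1 p2] p3 /=.
transitivity ((a ^+ 2 + b ^+ 2) * (q3 * p3 + (c * q1 + d * q2) * (c * p1 + d * p2))
  + (c * q2 - d * q1) * (c * p2 - d * p1)); last by ring.
rewrite A mul1r.
transitivity (q3 * p3 + (c ^+ 2 + d ^+ 2) * (q1 * p1 + q2 * p2)); last by ring.
by rewrite C; ring.
Qed.

(** This is the divergence of the field u^2 g(w) (p - w x).  The scalar product of
    grad u with p - w x is expanded, so that the formula holds whether or not
    grad u is known to be tangent to the sphere. *)
Definition div_field z : R :=
  2 * u (sph z) * g (dot (sph z) p) *
    (dot (grad u (sph z)) p - dot (sph z) p * dot (grad u (sph z)) (sph z)) +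
  u (sph z) ^+ 2 * (dg (dot (sph z) p) * (1 - dot (sph z) p ^+ 2)
    - 2 * dot (sph z) p * g (dot (sph z) p)).

Let div_fieldE z : D1 z + D2 z = div_field z * sin z.1.
Proof.
rewrite /div_field -/(w z) -/(G z) -(homext_sphere u (sphere_sph z)) -/(U z).
have f1 := frame z (G z); have f2 := frame z p.
have pp : dot p p = 1 by exact/sphereP.
rewrite pp !(dotC p) -/(w z) -/(wt z) -/(m z) in f2.
(* In coordinates, the divergence of p - w x is - 2 w. *)
have f3 : cos z.1 * wt z + sin z.1 * w z + mp z = 0.
  rewrite /wt /w /mp /dot /sph /eth /=; have A := cos2Dsin2 z.1.
  move: (cos z.1) (sin z.1) A => a b A.
  transitivity ((a ^+ 2 + b ^+ 2 - 1) * (cos z.2 * p.1.1 + sin z.2 * p.1.2)); first ring.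
  by rewrite A subrr mul0r.
have f3' : mp z = - (cos z.1 * wt z + sin z.1 * w z) by lra.
have f2' : 1 - w z ^+ 2 = wt z ^+ 2 + m z ^+ 2 by lra.
rewrite /D1 /D2 f1 f3' f2'.
move: (dot (G z) (eth z)) (dot (G z) (eph z)) (dot (G z) (sph z)) => k1 k2 k3.
by move: (U z) (g (w z)) (dg (w z)) (w z) (wt z) (m z) => *; ring.
Qed.

Lemma continuous_div_field : continuous (fun z => div_field z * sin z.1).
Proof. by apply: (ceq div_fieldE); exact: cA. Qed.

Lemma integral_div_field :
  (\int[leb2]_(z in @sph_dom R) (div_field z * sin z.1)%:E = 0)%E.
Proof.
under eq_integral do rewrite -div_fieldE EFinD.
rewrite integralD; first by rewrite intD1 intD2 adde0.
- exact: measurable_sph_dom.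
- exact: continuous_integrable_rect.
- exact: continuous_integrable_rect.
Qed.

(** The potential - div X - |X|^2 of the field X = g(w) (p - w x), as a function of
    t = w. *)
Definition hardy_potential (t : R) : R :=
  - dg t * (1 - t ^+ 2) + 2 * t * g t - g t ^+ 2 * (1 - t ^+ 2).

(* Adding the constant M makes both sides integrals of nonnegative functions, and
   these are always defined. *)
Variable M : R.
Hypothesis M0 : 0 <= M.
Hypothesis hM : forall t, -1 <= t <= 1 -> 0 <= M + hardy_potential t.

Let a z := u (sph z) ^+ 2 * (M + hardy_potential (dot (sph z) p)) * sin z.1.
Let b z := dot (grad u (sph z)) (grad u (sph z)) * sin z.1.
Let e z := M * u (sph z) ^+ 2 * sin z.1.
Let r z := b z + e z - a z - div_field z * sin z.1.

Let uU z : u (sph z) = U z.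
Proof. by rewrite /U homext_sphere //; exact: sphere_sph. Qed.

Let ca : continuous a.
Proof.
apply: (@ceq (fun z => U z ^+ 2 * (M + hardy_potential (w z)) * sin z.1)).
  by move=> z; rewrite /a uU.
have cw2 := cA (@cC 1) (cN (cM cw cw)).
refine (cM (cM (cM cU cU) (cA (@cC M) (cA (cA (cM (cN cdgw) cw2)
  (cM (cM (@cC 2) cw) cgw)) (cN (cM (cM cgw cgw) cw2))))) cs1).
Qed.

Let cb : continuous b.
Proof.
have [h1 h2 h3] := cGi.
refine (cM (cA (cA (cM h1 h1) (cM h2 h2)) (cM h3 h3)) cs1).
Qed.

Let ce : continuous e.
Proof.
apply: (@ceq (fun z => M * U z ^+ 2 * sin z.1)); first by move=> z; rewrite /e uU.
refine (cM (cM (@cC M) (cM cU cU)) cs1).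
Qed.

Let cr : continuous r.
Proof. exact: (cA (cA (cA cb ce) (cN ca)) (cN continuous_div_field)). Qed.

(* r is the density of |grad u - u X|^2 in coordinates. *)
Let r_ge0 z : sph_dom z -> 0 <= r z.
Proof.
move=> [/= z1 _]; have s0 : 0 <= sin z.1 by exact: sin_ge0_pi.
rewrite /r /b /e /a /div_field /hardy_potential.
have xx := dot_sph z; have pp : dot p p = 1 by exact/sphereP.
move: (sph z) xx => x xx.
move: (grad u x) (u x) => y v.
set k := g _; set dk := dg _; set c := dot x p.
rewrite (_ : _ - _ = ((y.1.1 - v * k * (p.1.1 - c * x.1.1)) ^+ 2 +
  (y.1.2 - v * k * (p.1.2 - c * x.1.2)) ^+ 2 +
  (y.2 - v * k * (p.2 - c * x.2)) ^+ 2) * sin z.1).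
  by rewrite mulr_ge0 // !addr_ge0 // sqr_ge0.
transitivity ((dot y y - 2 * v * k * (dot y p - c * dot y x)
   + v ^+ 2 * k ^+ 2 * (1 - c ^+ 2)) * sin z.1); first by ring.
congr (_ * _).
have -> : 1 - c ^+ 2 = dot p p - 2 * c * dot x p + c ^+ 2 * dot x x.
  by rewrite pp xx -/c; ring.
by clearbody k c; rewrite /dot; ring.
Qed.

Local Open Scope ereal_scope.

Let rect_int (f : R * R -> R) : continuous f -> leb2.-integrable (@sph_dom R) (EFin \o f).
Proof. exact: continuous_integrable_rect. Qed.

Let sum_ab : \int[leb2]_(z in @sph_dom R) (a z)%:E <=
  \int[leb2]_(z in @sph_dom R) (b z)%:E + \int[leb2]_(z in @sph_dom R) (e z)%:E.
Proof.
have mD := @measurable_sph_dom R.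
rewrite -integralD //; [|exact: rect_int..].
have -> : \int[leb2]_(z in @sph_dom R) ((b z)%:E + (e z)%:E) =
    \int[leb2]_(z in @sph_dom R) ((a z)%:E + ((r z)%:E + (div_field z * sin z.1)%:E)).
  by apply: eq_integral => z _; rewrite -!EFinD /r; congr EFin; ring.
have cd := continuous_div_field.
rewrite integralD //; last 2 first.
- exact: rect_int.
- exact: (rect_int (cA cr cd)).
rewrite integralD //; [|exact: rect_int..].
rewrite integral_div_field adde0 leeDl //.
by apply: integral_ge0 => z /r_ge0; rewrite lee_fin.
Qed.

(** Completing the square: the two sides differ by the integral of
    |grad u - u X|^2, up to the divergence of u^2 X, whose integral is 0. *)
Lemma hardy_smooth :
  \int[sigma]_(x in sphere) (u x ^+ 2 * (M + hardy_potential (dot x p)))%:E <=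
  sqnormL2v (grad u) + M%:E * sqnormL2 u.
Proof.
have mu := measurable_smooth_sphere su.
have mw := @measurable_sphere_comp_dot R p.
have mW : measurable_fun sphere (fun x => hardy_potential (dot x p)).
  have mg : measurable_fun sphere (fun x => g (dot x p)).
    by apply: mw => // t ht; exact: is_derive_continuous (hg ht).
  have mdg : measurable_fun sphere (fun x => dg (dot x p)) by exact: mw.
  have md : measurable_fun sphere (fun x => dot x p).
    by apply: measurable_funTS; exact: measurable_dotl.
  apply: measurable_funB; first (apply: measurable_funD).
  - apply: measurable_funM; first exact: measurable_funN.
    by apply: measurable_funB => //; exact: measurable_funX.
  - by apply: measurable_funM => //; exact: measurable_funM.
  - apply: measurable_funM; first exact: measurable_funX.
    by apply: measurable_funB => //; exact: measurable_funX.
have Ea : \int[sigma]_(x in sphere) (u x ^+ 2 * (M + hardy_potential (dot x p)))%:E =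
    \int[leb2]_(z in @sph_dom R) (a z)%:E.
  rewrite ge0_integral_sigma //.
  - apply/measurable_EFinP; apply: measurable_funM; first exact: measurable_funX.
    exact: measurable_funD.
  - move=> x sx; rewrite lee_fin mulr_ge0 ?sqr_ge0 // hM //.
    exact: dot_sphere_le1.
have Eb : sqnormL2v (grad u) = \int[leb2]_(z in @sph_dom R) (b z)%:E.
  rewrite /sqnormL2v ge0_integral_sigma.
  - by apply: eq_integral => z _; rewrite -EFinM sqr_enorm.
  - apply/measurable_EFinP; apply: (@measurable_sqr_enorm R (grad u)).
    + exact (measurable_grad_sphere ((1, 0, 0)%R : R3 R) su).
    + exact (measurable_grad_sphere ((0, 1, 0)%R : R3 R) su).
    + exact (measurable_grad_sphere ((0, 0, 1)%R : R3 R) su).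
  - by move=> x _; rewrite lee_fin sqr_ge0.
have Ee : M%:E * sqnormL2 u = \int[leb2]_(z in @sph_dom R) (e z)%:E.
  rewrite /sqnormL2 -ge0_integralZl_EFin //; last 3 first.
  - exact: measurable_sphere.
  - by move=> x _; rewrite lee_fin sqr_ge0.
  - by apply/measurable_EFinP; exact: measurable_funX.
  rewrite ge0_integral_sigma.
  - by apply: eq_integral => z _; rewrite -!EFinM.
  - apply/measurable_EFinP; apply: measurable_funM => //; exact: measurable_funX.
  - by move=> x _; rewrite -EFinM lee_fin mulr_ge0 ?sqr_ge0.
by rewrite Ea Eb Ee.
Qed.

End divergence.

(** * Passage to H^1 *)

Section smooth_density.
Variable R : realType.

(** A constant close to 1 in front of y^2 is what allows the sharp inequality, and
    not just a multiple of it, to survive the limit. *)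
Lemma sqr_young (eta x y : R) : 0 < eta ->
  x ^+ 2 <= (1 + eta) * y ^+ 2 + (1 + eta^-1) * (y - x) ^+ 2.
Proof.
move=> e0; rewrite -subr_ge0.
have eE : eta * eta^-1 = 1 by rewrite divff // gt_eqF.
have -> : (1 + eta) * y ^+ 2 + (1 + eta^-1) * (y - x) ^+ 2 - x ^+ 2 =
    eta * (y + eta^-1 * (y - x)) ^+ 2.
  transitivity (eta * y ^+ 2 + 2 * (eta * eta^-1) * y * (y - x)
     + (eta * eta^-1) * eta^-1 * (y - x) ^+ 2); last by ring.
  by rewrite eE; ring.
by rewrite mulr_ge0 ?sqr_ge0 // ltW.
Qed.

Lemma enorm_young (eta : R) (x y : R3 R) : 0 < eta ->
  enorm x ^+ 2 <= (1 + eta) * enorm y ^+ 2 + (1 + eta^-1) * enorm (x - y) ^+ 2.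
Proof.
move=> e0; rewrite !sqr_enorm /dot.
have h1 := sqr_young x.1.1 y.1.1 e0; have h2 := sqr_young x.1.2 y.1.2 e0.
have h3 := sqr_young x.2 y.2 e0; move: (eta^-1) h1 h2 h3 => i h1 h2 h3.
have d1 : (x - y).1.1 = x.1.1 - y.1.1 by [].
have d2 : (x - y).1.2 = x.1.2 - y.1.2 by [].
have d3 : (x - y).2 = x.2 - y.2 by [].
rewrite d1 d2 d3; lra.
Qed.

Local Open Scope ereal_scope.

Lemma le_integral_comb (k1 k2 : R) (F1 F2 F3 : R3 R -> R) :
  (0 <= k1)%R -> (0 <= k2)%R ->
  measurable_fun sphere F1 -> measurable_fun sphere F2 -> measurable_fun sphere F3 ->
  (forall x, sphere x -> 0 <= F1 x)%R -> (forall x, sphere x -> 0 <= F2 x)%R ->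
  (forall x, sphere x -> 0 <= F3 x)%R ->
  (forall x, sphere x -> F1 x <= k1 * F2 x + k2 * F3 x)%R ->
  \int[sigma]_(x in sphere) (F1 x)%:E <=
  k1%:E * \int[sigma]_(x in sphere) (F2 x)%:E + k2%:E * \int[sigma]_(x in sphere) (F3 x)%:E.
Proof.
move=> k10 k20 m1 m2 m3 p1 p2 p3 le.
have mS := @measurable_sphere R.
have M2 : measurable_fun sphere (fun x => (F2 x)%:E) by exact/measurable_EFinP.
have M3 : measurable_fun sphere (fun x => (F3 x)%:E) by exact/measurable_EFinP.
rewrite -!ge0_integralZl_EFin //.
rewrite -ge0_integralD //; last 4 first.
- by move=> x sx; rewrite mule_ge0 ?lee_fin // p2.
- exact: measurable_funeM.
- by move=> x sx; rewrite mule_ge0 ?lee_fin // p3.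
- exact: measurable_funeM.
apply: ge0_le_integral => //.
- exact/measurable_EFinP.
- by apply: emeasurable_funD; exact: measurable_funeM.
Qed.

Variable P : R3 R -> R.
Variables (K M : R).
Hypothesis mP : measurable_fun sphere P.
Hypothesis P0 : forall x, sphere x -> (0 <= P x)%R.
Hypothesis PK : forall x, sphere x -> (P x <= K)%R.
Hypothesis M0 : (0 <= M)%R.
Hypothesis smoothP : forall u, smooth_sphere u ->
  \int[sigma]_(x in sphere) (u x ^+ 2 * P x)%:E <= sqnormL2v (grad u) + M%:E * sqnormL2 u.

(** Replacing f by u n and u n by f costs a factor 1 + eta each time, plus multiples
    of the L^2 distances; these tend to 0 as n grows because P is bounded, and eta
    is arbitrary. *)
Lemma H1_of_smooth f G : H1_gradient f G ->
  \int[sigma]_(x in sphere) (f x ^+ 2 * P x)%:E <= sqnormL2v G + M%:E * sqnormL2 f.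
Proof.
move=> [[mf fL] [mG GL] [u [su uf uG]]].
have K0 : (0 <= K)%R.
  have s1 : sphere ((1, 0, 0)%R : R3 R).
    by apply/sphereP; rewrite /dot /= !mulr0 mulr1 !addr0.
  exact: le_trans (P0 s1) (PK s1).
have mG1 : measurable_fun sphere (fun x => (G x).1.1).
  by apply: measurableT_comp; [exact: measurable_fst |]; apply: measurableT_comp; [exact: measurable_fst |].
have mG2 : measurable_fun sphere (fun x => (G x).1.2).
  by apply: measurableT_comp; [exact: measurable_snd |]; apply: measurableT_comp; [exact: measurable_fst |].
have mG3 : measurable_fun sphere (fun x => (G x).2).
  by apply: measurableT_comp; [exact: measurable_snd |].
have mu n := measurable_smooth_sphere (su n).
have mg1 n := measurable_grad_sphere ((1, 0, 0)%R : R3 R) (su n).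
have mg2 n := measurable_grad_sphere ((0, 1, 0)%R : R3 R) (su n).
have mg3 n := measurable_grad_sphere ((0, 0, 1)%R : R3 R) (su n).
have mgu n : measurable_fun sphere (fun x => enorm (grad (u n) x) ^+ 2)%R.
  by apply: (@measurable_sqr_enorm R (grad (u n))); [exact (mg1 n) | exact (mg2 n) | exact (mg3 n)].
have mGn : measurable_fun sphere (fun x => enorm (G x) ^+ 2)%R.
  exact: (measurable_sqr_enorm mG1 mG2 mG3).
have mgd n : measurable_fun sphere (fun x => enorm (grad (u n) x - G x) ^+ 2)%R.
  apply: (@measurable_sqr_enorm R (fun x => grad (u n) x - G x)%R).
  - exact (measurable_funB (mg1 n) mG1).
  - exact (measurable_funB (mg2 n) mG2).
  - exact (measurable_funB (mg3 n) mG3).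
have mX (h : R3 R -> R) : measurable_fun sphere h -> measurable_fun sphere (fun x => h x ^+ 2)%R.
  by move=> mh; exact: measurable_funX.
have mud n : measurable_fun sphere (fun x => (u n x - f x) ^+ 2)%R.
  by apply: mX; exact: measurable_funB.
have n0 (h : R3 R -> R) : 0 <= sqnormL2 h by apply: integral_ge0 => x _; rewrite lee_fin sqr_ge0.
have nv0 (h : R3 R -> R3 R) : 0 <= sqnormL2v h by apply: integral_ge0 => x _; rewrite lee_fin sqr_ge0.
have Bfin : sqnormL2 f \is a fin_num by rewrite ge0_fin_numE.
have Afin : sqnormL2v G \is a fin_num by rewrite ge0_fin_numE.
move: uf uG => /fine_cvgP[Yfin Yc] /fine_cvgP[Xfin Xc].
set A := sqnormL2v G in Afin *; set B := sqnormL2 f in Bfin *.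
pose X n := sqnormL2v (fun x => grad (u n) x - G x)%R.
pose Y n := sqnormL2 (fun x => u n x - f x)%R.
set L := \int[sigma]_(x in sphere) _.
have step n (eta : R) : (0 < eta)%R -> X n \is a fin_num -> Y n \is a fin_num ->
  L <= ((1 + eta) ^+ 2 * (fine A + M * fine B) + (1 + eta) * (1 + eta^-1) * fine (X n)
   + ((1 + eta) * M * (1 + eta^-1) + (1 + eta^-1) * K) * fine (Y n))%:E.
  move=> e0 Xn Yn.
  have e1 : (0 <= 1 + eta)%R by rewrite addr_ge0 // ltW.
  have e2 : (0 <= 1 + eta^-1)%R by rewrite addr_ge0 // invr_ge0 ltW.
  have I1 : L <= (1 + eta)%:E * \int[sigma]_(x in sphere) (u n x ^+ 2 * P x)%:E +
     ((1 + eta^-1) * K)%:E * Y n.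
    apply: le_integral_comb => //.
    - by rewrite mulr_ge0.
    - by apply: measurable_funM => //; exact: mX.
    - by apply: measurable_funM => //; exact: mX.
    - by move=> x sx; rewrite mulr_ge0 ?sqr_ge0 ?P0.
    - by move=> x sx; rewrite mulr_ge0 ?sqr_ge0 ?P0.
    - by move=> x sx; rewrite sqr_ge0.
    - move=> x sx; have := ler_wpM2r (P0 sx) (sqr_young (f x) (u n x) e0).
      move=> /le_trans; apply; rewrite mulrDl -mulrA lerD2l -!mulrA ler_wpM2l //.
      by rewrite mulrA -expr2 [leRHS]mulrC ler_wpM2l ?sqr_ge0 ?PK.
  have I2 : sqnormL2v (grad (u n)) <= (1 + eta)%:E * A + (1 + eta^-1)%:E * X n.
    by apply: le_integral_comb => // x sx; rewrite ?sqr_ge0 //; exact: enorm_young.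
  have I3 : sqnormL2 (u n) <= (1 + eta)%:E * B + (1 + eta^-1)%:E * Y n.
    apply: le_integral_comb => // [||x sx|x sx|x sx|x sx]; rewrite ?sqr_ge0 //; [exact: mX | exact: mX |].
    rewrite -(sqrrN (u n x - f x)) opprB; exact: sqr_young.
  apply: le_trans I1 _.
  have M0' : 0 <= M%:E by rewrite lee_fin.
  have I4 := le_trans (smoothP (su n)) (leeD I2 (lee_wpmul2l M0' I3)).
  have e1' : 0 <= (1 + eta)%:E by rewrite lee_fin.
  apply: le_trans (leeD (lee_wpmul2l e1' I4) (lexx _)) _.
  rewrite -(fineK Afin) -(fineK Bfin) -(fineK Xn) -(fineK Yn).
  rewrite -?EFinM -?EFinD -?EFinM -?EFinD -?EFinM -?EFinD lee_fin.
  by rewrite le_eqVlt; apply/orP; left; apply/eqP; move: (eta^-1)%R => i; ring.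
have lim (eta : R) : (0 < eta)%R -> L <= ((1 + eta) ^+ 2 * (fine A + M * fine B))%:E.
  move=> e0; set s := (_ * _)%R.
  set c1 := ((1 + eta) * (1 + eta^-1))%R.
  set c2 := ((1 + eta) * M * (1 + eta^-1) + (1 + eta^-1) * K)%R.
  have cv : (s + c1 * fine (X n) + c2 * fine (Y n))%R @[n --> \oo] --> (s + c1 * 0 + c2 * 0)%R.
    apply: cvgD; first (apply: cvgD; first exact: cvg_cst).
    - by apply: cvgMl_tmp.
    - by apply: cvgMl_tmp.
  rewrite !mulr0 !addr0 in cv.
  have cvE : (s + c1 * fine (X n) + c2 * fine (Y n))%:E @[n --> \oo] --> s%:E.
    by apply: cvg_EFin => //; exact: nearW.
  apply: (cvge_to_ge cvE); near=> n; apply: step => //; near: n => //.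
have s0 : (0 <= fine A + M * fine B)%R.
  by rewrite addr_ge0 ?mulr_ge0 ?fine_ge0 ?n0 ?nv0.
have L0 : 0 <= L.
  by apply: integral_ge0 => x sx; rewrite lee_fin mulr_ge0 ?sqr_ge0 ?P0.
have Lfin : L \is a fin_num by rewrite ge0_fin_numE // (le_lt_trans (lim 1%R ltr01)) ?ltry.
rewrite -/A -/B -(fineK Afin) -(fineK Bfin) -EFinM -EFinD -(fineK Lfin) lee_fin.
set s := (_ + _)%R in s0 *; apply/ler_addgt0Pl => e e0.
(* For eta <= 1, (1 + eta)^2 s <= s + 3 eta s <= s + e. *)
pose eta := (e / (3 * s + e))%R.
have d0 : (0 < 3 * s + e)%R by rewrite ltr_wpDl // mulr_ge0.
have eta0 : (0 < eta)%R by rewrite divr_gt0.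
have eta1 : (eta <= 1)%R by rewrite ler_pdivrMr // mul1r lerDr mulr_ge0.
have etas : (3 * eta * s <= e)%R.
  rewrite mulrAC /eta mulrA ler_pdivrMr // mulrC ler_pM2l // lerDl ltW //.
have := lim _ eta0; rewrite -(fineK Lfin) lee_fin => /le_trans; apply.
have es : (0 <= eta * s * (1 - eta))%R.
  by apply: mulr_ge0; [apply: mulr_ge0 => //; exact: ltW | rewrite subr_ge0].
by rewrite -/s; clear -etas es; lra.
Unshelve. all: by end_near. Qed.

End smooth_density.

Section hardy_H1.
Variable R : realType.

Lemma continuous_hardy_potential (g dg : R -> R) (t : R) :
  {for t, continuous g} -> {for t, continuous dg} ->
  {for t, continuous (hardy_potential g dg)}.
Proof.
move=> cg cdg.
have cid : {for t, continuous (fun s : R => s)} by exact: cvg_id.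
have c1 : {for t, continuous (fun s : R => 1 - s ^+ 2)}.
  by apply: cvgB; [exact: cvg_cst | exact: (cvgM cid cid)].
apply: cvgB; [apply: cvgD|].
- by apply: cvgM c1; exact: cvgN.
- by apply: cvgM cg; apply: cvgM cid; exact: cvg_cst.
- by apply: cvgM c1; exact: (cvgM cg cg).
Qed.

Local Open Scope ereal_scope.

(** The potential of a C^1 field is continuous on [-1, 1], hence bounded, as
    [H1_of_smooth] demands. *)
Lemma hardy_H1 (p : R3 R) (g dg : R -> R) (M : R) f G : sphere p ->
  (forall t : R, (-1 <= t <= 1)%R -> is_derive t (1%R : R) g (dg t)) ->
  (forall t : R, (-1 <= t <= 1)%R -> {for t, continuous dg}) ->
  (0 <= M)%R ->
  (forall t, -1 <= t <= 1 -> 0 <= M + hardy_potential g dg t)%R ->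
  H1_gradient f G ->
  \int[sigma]_(x in sphere) (f x ^+ 2 * (M + hardy_potential g dg (dot x p)))%:E <=
  sqnormL2v G + M%:E * sqnormL2 f.
Proof.
move=> sp hg cdg M0 hM fG.
have cW (t : R) : (-1 <= t <= 1)%R -> {for t, continuous (hardy_potential g dg)}.
  move=> ht; apply: continuous_hardy_potential; last exact: cdg.
  exact: is_derive_continuous (hg t ht).
have mW : measurable_fun sphere (fun x => hardy_potential g dg (dot x p)).
  exact: measurable_sphere_comp_dot.
have [c cI cmax] : exists2 c : R, c \in `[(-1)%R, 1%R] & forall t, t \in `[(-1)%R, 1%R] ->
    (hardy_potential g dg t <= hardy_potential g dg c)%R.
  apply: EVT_max; first by lra.
  apply: continuous_in_subspaceT => t; rewrite inE /= in_itv /=; exact: cW.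
apply: (@H1_of_smooth _ _ (M + hardy_potential g dg c)%R M) => //.
- by apply: measurable_funD => //; exact: measurable_cst.
- by move=> x sx; apply: hM; exact: dot_sphere_le1.
- by move=> x sx; rewrite lerD2l cmax // in_itv /= dot_sphere_le1.
- by move=> u su; exact: hardy_smooth.
Qed.

End hardy_H1.

Section regularized_field.
Variable R : realType.
Local Notation c := (1 + ln pi : R).
Variable e : R.
Hypothesis e01 : 0 < e <= 1.

(** The regularization 1 + e - t^2 of sin^2 theta = 1 - t^2. *)
Definition qreg (t : R) : R := 1 + e - t ^+ 2.
Definition psireg (t : R) : R := c - ln (qreg t) / 2.
(** The derivative in t of ln (psireg^(1/2)), that is, the field of the ground state. *)
Definition greg (t : R) : R := t / (2 * qreg t * psireg t).
Definition dgreg (t : R) : R := (2 * qreg t * psireg t)^-1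
  + t ^+ 2 / (qreg t ^+ 2 * psireg t) - t ^+ 2 / (2 * qreg t ^+ 2 * psireg t ^+ 2).

Let q_bounds t : -1 <= t <= 1 -> e <= qreg t /\ 1 - t ^+ 2 <= qreg t /\ qreg t <= 2.
Proof.
move=> /andP[t1 t2]; have := sqr_ge0 t; have t3 : t ^+ 2 <= 1 by nra.
by rewrite /qreg; case/andP: e01 => *; do !split; lra.
Qed.

Let q_gt0 t : -1 <= t <= 1 -> 0 < qreg t.
Proof. by case/q_bounds=> + _; case/andP: e01 => e0 _; exact: lt_le_trans. Qed.

Let psireg_ge1 t : -1 <= t <= 1 -> 1 <= psireg t.
Proof.
move=> ht; have [_ [_ q2]] := q_bounds ht.
have : ln (qreg t) <= ln 2 by rewrite ler_ln ?posrE // q_gt0.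
have := @ln2_le R; have := c_ge R; rewrite /psireg; lra.
Qed.

Lemma is_derive_greg (t : R) : -1 <= t <= 1 -> is_derive t (1 : R) greg (dgreg t).
Proof.
move=> ht; have q0 := q_gt0 ht; have p1 := psireg_ge1 ht.
have p0 : psireg t != 0 by rewrite gt_eqF //; lra.
have q0' : qreg t != 0 by rewrite gt_eqF.
have dq : is_derive t (1 : R) qreg (- (2 * t)).
  by rewrite /qreg; apply: is_derive_eq; rewrite /GRing.scale /=; ring.
have dl : is_derive t (1 : R) (fun s => ln (qreg s)) ((qreg t)^-1 * - (2 * t)).
  exact: (@is_derive1_comp _ (@ln R) qreg t _ _ (is_derive1_ln q0) dq).
have dp : is_derive t (1 : R) psireg (t / qreg t).
  by rewrite /psireg; apply: is_derive_eq; rewrite /GRing.scale /=; field.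
have dd : is_derive t (1 : R) (fun s => 2 * qreg s * psireg s)
   (2 * (- (2 * t)) * psireg t + 2 * qreg t * (t / qreg t)).
  by apply: is_derive_eq; rewrite /GRing.scale /=; ring.
have d0 : 2 * qreg t * psireg t != 0 by rewrite !mulf_neq0.
have dV := @is_deriveV _ (fun s => 2 * qreg s * psireg s) t _ 1 d0 dd.
rewrite /greg /dgreg.
apply: is_derive_eq; rewrite /GRing.scale /=.
by field; rewrite p0 q0'.
Qed.

Lemma hardy_potential_reg (t : R) : -1 <= t <= 1 ->
  hardy_potential greg dgreg t =
  (1 - t ^+ 2) * (t ^+ 2 / (4 * qreg t ^+ 2 * psireg t ^+ 2) - (2 * qreg t * psireg t)^-1)
   + t ^+ 2 / (qreg t * psireg t) * (1 - (1 - t ^+ 2) / qreg t).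
Proof.
move=> ht; have q0 := q_gt0 ht; have p1 := psireg_ge1 ht.
rewrite /hardy_potential /greg /dgreg; field.
by rewrite !gt_eqF //; lra.
Qed.

(** The only negative term is (1 - t^2) / (2 qreg psireg), at most 1/2 because
    qreg >= 1 - t^2 and psireg >= 1.  The bound -1 does not depend on e, as Fatou's
    lemma asks. *)
Lemma hardy_potential_reg_ge (t : R) : -1 <= t <= 1 -> 0 <= 1 + hardy_potential greg dgreg t.
Proof.
move=> ht; have q0 := q_gt0 ht; have p1 := psireg_ge1 ht.
have [_ [q1 _]] := q_bounds ht.
rewrite hardy_potential_reg //.
have s0 : 0 <= 1 - t ^+ 2 by case/andP: ht => *; nra.
have p0 : 0 < psireg t by lra.
have t2 := sqr_ge0 t.
have h1 : 0 <= t ^+ 2 / (4 * qreg t ^+ 2 * psireg t ^+ 2).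
  apply: divr_ge0 => //; apply: mulr_ge0; last exact: sqr_ge0.
  by apply: mulr_ge0 => //; exact: sqr_ge0.
have h2 : (1 - t ^+ 2) * (2 * qreg t * psireg t)^-1 <= 1.
  rewrite ler_pdivrMr ?mulr_gt0 // mul1r.
  have := mulr_ge0 (ltW q0) (_ : 0 <= psireg t - 1); rewrite subr_ge0 => /(_ p1); lra.
have h3 : 0 <= t ^+ 2 / (qreg t * psireg t) * (1 - (1 - t ^+ 2) / qreg t).
  apply: mulr_ge0; first by apply: divr_ge0 => //; apply: mulr_ge0; exact: ltW.
  rewrite subr_ge0.
  by rewrite ler_pdivrMr // mul1r.
have h4 := mulr_ge0 s0 h1.
rewrite mulrBr; lra.
Qed.

Lemma hardy_potential_reg_pole_ge0 (t : R) : t ^+ 2 = 1 ->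
  0 <= hardy_potential greg dgreg t.
Proof.
move=> t2; have ht : -1 <= t <= 1 by apply/andP; split; nra.
have q0 := q_gt0 ht; have p1 := psireg_ge1 ht.
rewrite hardy_potential_reg // t2 subrr !mul0r add0r subr0 mulr1.
by rewrite divr_ge0 // mulr_ge0 // ltW // (lt_le_trans _ p1).
Qed.

Lemma continuous_dgreg (t : R) : -1 <= t <= 1 -> {for t, continuous dgreg}.
Proof.
move=> ht; have q0 := q_gt0 ht; have p1 := psireg_ge1 ht.
have p0 : psireg t != 0 by rewrite gt_eqF //; lra.
have q0' : qreg t != 0 by rewrite gt_eqF.
have cid : {for t, continuous (fun s : R => s)} by exact: cvg_id.
have cC (k : R) : {for t, continuous (fun _ : R => k)} by exact: cvg_cst.
have ct2 : {for t, continuous (fun s : R => s ^+ 2)} by exact: (cvgM cid cid).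
have cq : {for t, continuous qreg} by apply: cvgB; [exact: cC | exact: ct2].
have cp : {for t, continuous psireg}.
  apply: cvgB; first exact: cC.
  apply: cvgM; last exact: cC.
  by apply: continuous_comp cq _; exact: continuous_ln.
have cq2 : {for t, continuous (fun s => qreg s ^+ 2)} by exact: (cvgM cq cq).
have cp2 : {for t, continuous (fun s => psireg s ^+ 2)} by exact: (cvgM cp cp).
apply: cvgB; first apply: cvgD.
- by apply: cvgV; [rewrite !mulf_neq0 | apply: cvgM cp; apply: cvgM cq; exact: cC].
- apply: cvgM ct2 _; apply: cvgV; first by rewrite !mulf_neq0 // expf_neq0.
  exact: cvgM cq2 cp.
- apply: cvgM ct2 _; apply: cvgV; first by rewrite !mulf_neq0 // expf_neq0.
  by apply: cvgM cp2; apply: cvgM cq2; exact: cC.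
Qed.

End regularized_field.

(** * The singular Hardy inequality *)

Section limit_potential.
Variable R : realType.
Local Notation c := (1 + ln pi : R).

(** The functions psi and cot^2 / (4 psi^2) - 1 / (2 psi) of the polar angle, in the
    variable t = cos theta. *)
Definition psidot (t : R) : R := c - ln (1 - t ^+ 2) / 2.
Definition hardy_limit (t : R) : R :=
  t ^+ 2 / (4 * (1 - t ^+ 2) * psidot t ^+ 2) - (2 * psidot t)^-1.

Definition Ioo : set R := `]-1, 1[%classic.

Lemma IooP (t : R) : Ioo t <-> -1 < t < 1.
Proof. by rewrite /Ioo /= in_itv. Qed.

Lemma one_sub_sqr_gt0 (t : R) : -1 < t < 1 -> 0 < 1 - t ^+ 2.
Proof. by move=> /andP[t1 t2]; nra. Qed.

Lemma psidot_gt0 (t : R) : -1 < t < 1 -> 0 < psidot t.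
Proof.
move=> ht; have h : 1 - t ^+ 2 <= 1 by rewrite gerBl sqr_ge0.
have := ln_le0 h; have := c_ge R; rewrite /psidot; lra.
Qed.

Local Notation W n := (hardy_potential (greg n.+1%:R^-1) (dgreg n.+1%:R^-1)).

Let e01 n : 0 < (n.+1%:R^-1 : R) <= 1.
Proof. by rewrite invr_gt0 ltr0Sn invf_le1 // ler1n. Qed.

Lemma hardy_potential_reg_cvg (t : R) : -1 < t < 1 ->
  W n t @[n --> \oo] --> hardy_limit t.
Proof.
move=> ht; have ht' : -1 <= t <= 1 by case/andP: ht => *; rewrite !ltW.
have q0 := one_sub_sqr_gt0 ht; have p0 := psidot_gt0 ht.
have qn0 : 1 - t ^+ 2 != 0 by rewrite gt_eqF.
have pn0 : psidot t != 0 by rewrite gt_eqF.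
under eq_fun do rewrite (hardy_potential_reg (e01 _) ht').
have cq : qreg n.+1%:R^-1 t @[n --> \oo] --> 1 - t ^+ 2.
  have -> : 1 - t ^+ 2 = 1 + 0 - t ^+ 2 by rewrite addr0.
  apply: cvgB; last exact: cvg_cst.
  by apply: cvgD; [exact: cvg_cst | exact: cvg_harmonic].
have cp : psireg n.+1%:R^-1 t @[n --> \oo] --> psidot t.
  apply: cvgB; first exact: cvg_cst.
  apply: cvgM; last exact: cvg_cst.
  by apply: continuous_cvg cq; exact: continuous_ln.
have cq2 : qreg n.+1%:R^-1 t ^+ 2 @[n --> \oo] --> (1 - t ^+ 2) ^+ 2 by exact: (cvgM cq cq).
have cp2 : psireg n.+1%:R^-1 t ^+ 2 @[n --> \oo] --> psidot t ^+ 2 by exact: (cvgM cp cp).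
have -> : hardy_limit t =
  (1 - t ^+ 2) * (t ^+ 2 / (4 * (1 - t ^+ 2) ^+ 2 * psidot t ^+ 2)
     - (2 * (1 - t ^+ 2) * psidot t)^-1)
   + t ^+ 2 / ((1 - t ^+ 2) * psidot t) * (1 - (1 - t ^+ 2) / (1 - t ^+ 2)).
  rewrite /hardy_limit divff // subrr mulr0 addr0.
  by move: (1 - t ^+ 2) (psidot t) (t ^+ 2) qn0 pn0 => q P s q1 P1; field; rewrite q1 P1.
have cC (k : R) : k @[_ --> \oo] --> k by exact: cvg_cst.
apply: cvgD; apply: cvgM; first exact: cC.
- apply: cvgB.
  + apply: cvgM; first exact: cC.
    apply: cvgV; first by rewrite !mulf_neq0 // expf_neq0.
    by apply: cvgM cp2; apply: cvgM cq2; exact: cC.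
  + apply: cvgV; first by rewrite !mulf_neq0.
    by apply: cvgM cp; apply: cvgM cq; exact: cC.
- apply: cvgM; first exact: cC.
  by apply: cvgV; [rewrite mulf_neq0 | exact: cvgM cq cp].
- apply: cvgB; first exact: cC.
  apply: cvgM; first exact: cC.
  by apply: cvgV.
Qed.

Lemma continuous_hardy_reg n (t : R) : -1 <= t <= 1 -> {for t, continuous (W n)}.
Proof.
move=> ht.
apply: continuous_hardy_potential; last exact: continuous_dgreg.
exact: is_derive_continuous (is_derive_greg (e01 n) ht).
Qed.

Lemma measurable_Ioo : measurable (Ioo : set (measurableTypeR R)).
Proof. exact: measurable_itv. Qed.

Lemma measurable_patch_Ioo (k : R -> R) :
  (forall t : R, -1 < t < 1 -> {for t, continuous k}) ->
  measurable_fun setT (k \_ Ioo).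
Proof.
move=> ck; apply/(measurable_restrictT _ measurable_Ioo).
apply: open_continuous_measurable_fun; first exact: interval_open.
by move=> t; rewrite inE => /IooP; exact: ck.
Qed.

Local Open Scope ereal_scope.

(** Fatou's lemma for the regularized inequalities with e = 1/(n+1).  At the two
    poles the regularized potentials are nonnegative and need not converge; they
    are replaced there by 0, which only decreases the left-hand side. *)
Lemma hardy_limit_inequality (p : R3 R) f G : sphere p -> H1_gradient f G ->
  \int[sigma]_(x in sphere) (f x ^+ 2 * (1 + (hardy_limit \_ Ioo) (dot x p)))%:E <=
  sqnormL2v G + sqnormL2 f.
Proof.
move=> sp fG; have [[mf fL] _ _] := fG.
have mf2 : measurable_fun sphere (fun x => f x ^+ 2)%R by exact: measurable_funX.
have md : measurable_fun sphere (fun x => dot x p).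
  by apply: measurable_funTS; exact: measurable_dotl.
pose F n x := (f x ^+ 2 * (1 + (W n \_ Ioo) (dot x p)))%:E.
have W0 n (t : R) : (-1 <= t <= 1 -> 0 <= 1 + W n t)%R by exact: (hardy_potential_reg_ge (e01 n)).
have WI0 n x : sphere x -> (0 <= 1 + (W n \_ Ioo) (dot x p))%R.
  move=> sx; rewrite patchE; case: ifPn => _; last by rewrite addr0.
  exact/W0/dot_sphere_le1.
have mF n : measurable_fun sphere (F n).
  apply/measurable_EFinP; apply: measurable_funM => //; apply: measurable_funD => //.
  apply: measurableT_comp md; apply: measurable_patch_Ioo => t /andP[t1 t2].
  by apply: continuous_hardy_reg; rewrite !ltW.
have F0 n x : sphere x -> 0 <= F n x.
  by move=> sx; rewrite lee_fin mulr_ge0 ?sqr_ge0 ?WI0.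
have Fle n : \int[sigma]_(x in sphere) F n x <= sqnormL2v G + sqnormL2 f.
  have := @hardy_H1 R p _ _ 1 f G sp (is_derive_greg (e01 n)) (continuous_dgreg (e01 n)) ler01 (W0 n) fG.
  rewrite mul1e; apply: le_trans.
  apply: ge0_le_integral.
  - exact: measurable_sphere.
  - by move=> x sx; exact: F0.
  - exact: mF.
  - apply/measurable_EFinP; apply: measurable_funM => //; apply: measurable_funD => //.
    by apply: measurable_sphere_comp_dot => //; exact: continuous_hardy_reg.
  - move=> x sx; rewrite lee_fin ler_wpM2l ?sqr_ge0 // lerD2l patchE.
    case: ifPn => // tI; apply: hardy_potential_reg_pole_ge0 => //.
    have /andP[t1 t2] := dot_sphere_le1 sx sp.
    have [tl|tl] := ltP (dot x p) 1%R; last first.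
      have -> : dot x p = 1%R by apply/eqP; rewrite eq_le t2 tl.
      by rewrite expr1n.
    have [tg|tg] := ltP (-1)%R (dot x p).
      by move: tI; rewrite notin_setE => /IooP; rewrite tl tg.
    have -> : dot x p = (-1)%R by apply/eqP; rewrite eq_le t1 tg.
    by rewrite sqrrN expr1n.
have Fcvg x : sphere x ->
    F n x @[n --> \oo] --> (f x ^+ 2 * (1 + (hardy_limit \_ Ioo) (dot x p)))%:E.
  move=> sx; apply: cvg_EFin; first exact: nearW.
  apply: cvgM; first exact: cvg_cst.
  apply: cvgD; first exact: cvg_cst.
  rewrite /= !patchE; case: ifPn => [|nI].
    move=> tI; under eq_fun do rewrite patchE tI.
    by apply: hardy_potential_reg_cvg; move: tI; rewrite inE => /IooP.
  by under eq_fun do rewrite patchE (negbTE nI); exact: cvg_cst.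
have -> : \int[sigma]_(x in sphere) (f x ^+ 2 * (1 + (hardy_limit \_ Ioo) (dot x p)))%:E =
    \int[sigma]_(x in sphere) limn_einf (F ^~ x).
  apply: eq_integral => x; rewrite inE => sx.
  by have [-> _] := cvg_limn_einf_sup (Fcvg x sx).
have := @fatou _ _ R sigma _ (@measurable_sphere R) F mF F0 => /le_trans; apply.
rewrite limn_einf_lim; apply: lime_le; first exact: is_cvg_einfs.
apply: nearW => n; apply: le_trans (Fle n).
by apply: ereal_inf_lbound; exists n => //=.
Qed.

End limit_potential.

(** * The equality case *)

Section equator.
Variable R : realType.

(* The derivative of gat N at 0 is - N, while gat N itself is bounded uniformly in N:
   the potential concentrates on the equator at a bounded cost. *)
Let gat (N : R) (t : R) : R := - atan (N * t).
Let dgat (N : R) (t : R) : R := - ((1 + (N * t) ^+ 2)^-1 * N).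

Let den_gt0 (N t : R) : 0 < 1 + (N * t) ^+ 2.
Proof. by rewrite ltr_pwDl // sqr_ge0. Qed.

Let is_derive_gat (N t : R) : is_derive t (1 : R) (gat N) (dgat N t).
Proof.
have h1 : is_derive t (1 : R) (fun s : R => N * s) N.
  by apply: is_derive_eq; rewrite /GRing.scale /=; ring.
exact: is_deriveN (@is_derive1_comp _ (@atan R) (fun s => N * s) t _ _ (is_derive1_atan (N * t)) h1).
Qed.

Let continuous_dgat (N t : R) : {for t, continuous (dgat N)}.
Proof.
have cid : {for t, continuous (fun s : R => N * s)}.
  by apply: cvgM; [exact: cvg_cst | exact: cvg_id].
apply: cvgN; apply: cvgM; last exact: cvg_cst.
apply: cvgV; first by rewrite gt_eqF.
by apply: cvgD; [exact: cvg_cst | exact: (cvgM cid cid)].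
Qed.

Let atan_bound (s : R) : - 2 <= atan s <= 2.
Proof.
have h1 := atan_gtNpi2 s; have h2 := atan_ltpi2 s; have h3 := @pihalf_lt2 R.
by apply/andP; split; lra.
Qed.

(* With |atan| <= 2 and |t| <= 1, the second and third terms of the potential are
   at least - 4 each. *)
Let hardy_gat_ge0 (N t : R) : 0 <= N -> -1 <= t <= 1 ->
  0 <= 8 + hardy_potential (gat N) (dgat N) t.
Proof.
move=> N0 /andP[t1 t2]; rewrite /hardy_potential /gat /dgat.
have /andP[a1 a2] := atan_bound (N * t).
have s0 : 0 <= 1 - t ^+ 2 by nra.
have : 0 <= (1 + (N * t) ^+ 2)^-1 * N * (1 - t ^+ 2).
  by rewrite !mulr_ge0 // invr_ge0 ltW.
move: (atan _) a1 a2 ((_)^-1) => a a1 a2 i h.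
have h1 : t * a <= 2 by nra.
have h2 : a ^+ 2 <= 4 by nra.
have h3 : 0 <= t ^+ 2 by rewrite sqr_ge0.
rewrite sqrrN; nra.
Qed.

Local Open Scope ereal_scope.

Lemma measurable_equator (p : R3 R) :
  measurable_fun sphere (fun x => (dot x p == 0%R)%:R : R).
Proof.
have md : measurable_fun sphere (fun x => dot x p).
  by apply: measurable_funTS; exact: measurable_dotl.
have -> : (fun x => (dot x p == 0%R)%:R : R) = \1_[set 0%R] \o (fun x => dot x p).
  apply/funext => x; rewrite /= indicE; have [->|h] := eqVneq (dot x p) 0%R; first by rewrite mem_set.
  by rewrite memNset //; apply/eqP.
by apply: measurableT_comp md; exact: measurable_indic.
Qed.

(** The field - atan(N t) gives N times the integral a bound that does not depend
    on N. *)
Lemma equator_negligible (p : R3 R) f G : sphere p -> H1_gradient f G ->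
  \int[sigma]_(x in sphere) (f x ^+ 2 * (dot x p == 0%R)%:R)%:E = 0.
Proof.
move=> sp fG; have [[mf fL] [mG GL] _] := fG.
have mf2 : measurable_fun sphere (fun x => f x ^+ 2)%R by exact: measurable_funX.
have md : measurable_fun sphere (fun x => dot x p).
  by apply: measurable_funTS; exact: measurable_dotl.
have mE := measurable_equator p.
have mI : measurable_fun sphere (fun x => f x ^+ 2 * (dot x p == 0%R)%:R)%R.
  exact: measurable_funM.
set Z := \int[sigma]_(x in sphere) _.
have Z0 : 0 <= Z by apply: integral_ge0 => x _; rewrite lee_fin mulr_ge0 ?sqr_ge0.
set S := sqnormL2v G + 8%:E * sqnormL2 f.
have S0 : 0 <= S.
  rewrite adde_ge0 ?mule_ge0 ?lee_fin //; by apply: integral_ge0 => x _; rewrite lee_fin sqr_ge0.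
have Sfin : S \is a fin_num.
  by rewrite ge0_fin_numE // lte_add_pinfty // lte_mul_pinfty ?lee_fin.
have step (N : R) : (0 <= N)%R -> N%:E * Z <= S.
  move=> N0.
  have := @hardy_H1 R p (gat N) (dgat N) 8 f G sp (fun t _ => is_derive_gat N t)
    (fun t _ => @continuous_dgat N t) (ler0n _ _) (fun t => hardy_gat_ge0 N0) fG.
  apply: le_trans; rewrite -ge0_integralZl_EFin //; last 3 first.
  - exact: measurable_sphere.
  - by move=> x _; rewrite lee_fin mulr_ge0 ?sqr_ge0.
  - exact/measurable_EFinP.
  apply: ge0_le_integral.
  - exact: measurable_sphere.
  - by move=> x _; rewrite -EFinM lee_fin; apply: mulr_ge0 => //; apply: mulr_ge0 => //; exact: sqr_ge0.
  - by apply: measurable_funeM; apply/measurable_EFinP.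
  - apply/measurable_EFinP; apply: measurable_funM => //; apply: measurable_funD => //.
    apply: measurable_sphere_comp_dot => // t _.
    apply: continuous_hardy_potential; last exact: continuous_dgat.
    exact: is_derive_continuous (is_derive_gat N t).
  - move=> x sx; rewrite -EFinM lee_fin mulrCA ler_wpM2l ?sqr_ge0 //.
    have [->|_] := eqVneq (dot x p) 0%R; last by rewrite mulr0 hardy_gat_ge0 // dot_sphere_le1.
    rewrite /hardy_potential /gat /dgat !mulr0 atan0 oppr0 !mulr0 expr0n /= mul0r !subr0 !addr0 !mulr1.
    by rewrite invr1 mul1r opprK; lra.
have Zfin : Z \is a fin_num.
  rewrite ge0_fin_numE //; apply: le_lt_trans (_ : S < +oo); last by rewrite -ge0_fin_numE.
  by have := step 1%R ler01; rewrite mul1e.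
apply/eqP; rewrite eq_le Z0 andbT leNgt; apply/negP => Zp.
move: step; rewrite -(fineK Sfin) -(fineK Zfin).
have zp : (0 < fine Z)%R by rewrite fine_gt0 // Zp -ge0_fin_numE.
have sp0 : (0 <= fine S)%R by rewrite fine_ge0.
(* This value of N would give fine S + 1 <= fine S. *)
move=> /(_ ((fine S + 1) / fine Z)%R); rewrite divr_ge0 ?addr_ge0 ?(ltW zp) // => /(_ isT).
by rewrite -EFinM lee_fin divfK ?gt_eqF // leNgt ltrDl ltr01.
Qed.

End equator.

Section conclusion.
Variable R : realType.

Lemma dot_lt1 (x p : R3 R) : sphere x -> sphere p -> x != p -> x != - p ->
  -1 < dot x p < 1.
Proof.
move=> /sphereP hx /sphereP hp xp xNp.
have sep (y z : R3 R) : y != z ->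
    0 < (y.1.1 - z.1.1) ^+ 2 + (y.1.2 - z.1.2) ^+ 2 + (y.2 - z.2) ^+ 2.
  move=> yz; rewrite lt_neqAle; apply/andP; split; last by rewrite !addr_ge0 ?sqr_ge0.
  apply: contra yz; rewrite eq_sym !paddr_eq0 ?addr_ge0 ?sqr_ge0 // !sqrf_eq0 !subr_eq0.
  move: y z => [[y1 y2] y3] [[z1 z2] z3] /=.
  by move=> /andP[/andP[/eqP -> /eqP ->] /eqP ->].
have := sep _ _ xp; have := sep _ _ xNp.
rewrite -[(- p).1.1]/(- p.1.1) -[(- p).1.2]/(- p.1.2) -[(- p).2]/(- p.2).
by move: hx hp; rewrite /dot => *; apply/andP; split; lra.
Qed.

Lemma dot_selfN (p : R3 R) : sphere p -> dot (- p) p = -1.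
Proof.
move=> /sphereP <-; rewrite /dot.
rewrite -[(- p).1.1]/(- p.1.1) -[(- p).1.2]/(- p.1.2) -[(- p).2]/(- p.2); ring.
Qed.

Variables (p : R3 R) (chi : R -> R) (C : R).
Hypothesis sp : sphere p.
Hypothesis C04 : 0 < C <= 4.

(* The weight of Q, as a function of t = cos theta. *)
Let V (t : R) : R :=
  4^-1 * ((rho chi (acos t) ^+ 2)^-1 + (rho chi (pi - acos t) ^+ 2)^-1).

Hypothesis cV : forall t : R, -1 < t < 1 -> {for t, continuous V}.
Hypothesis V_le : forall t : R, -1 < t < 1 -> V t <= C / 4 + hardy_limit t.
Hypothesis V_lt : forall t : R, -1 < t < 1 -> t != 0 -> V t < C / 4 + hardy_limit t.

Local Open Scope ereal_scope.

Let QE f : measurable_fun sphere f ->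
  Q p chi f = \int[sigma]_(x in sphere) (f x ^+ 2 * (V \_ (@Ioo R)) (dot x p))%:E.
Proof.
move=> mf; rewrite /Q.
have V0 t : (0 <= (V \_ (@Ioo R)) t)%R.
  rewrite patchE; case: ifPn => // _.
  by rewrite /V mulr_ge0 // addr_ge0 // invr_ge0 sqr_ge0.
have -> : \int[sigma]_(x in sphere `\` [set p; (- p)%R])
    (f x ^+ 2 / rho chi (geodist x p) ^+ 2
     + f x ^+ 2 / rho chi (pi - geodist x p) ^+ 2)%:E =
  \int[sigma]_(x in sphere) (4%:E * (f x ^+ 2 * (V \_ (@Ioo R)) (dot x p))%:E).
  rewrite integral_mkcond [RHS]integral_mkcond; apply: eq_integral => x _.
  rewrite !patchE; case: (pselect (sphere x)) => sx; last first.
    by rewrite !ifF //; apply/negP; rewrite inE //= => -[].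
  rewrite [in RHS]ifT ?inE //.
  have [->|xp] := eqVneq x p.
    rewrite ifF; last by apply/negP; rewrite inE /= => -[_ []]; left.
    rewrite ifF ?mulr0 ?mule0 //; apply/negP; rewrite inE => /IooP.
    by have /sphereP -> := sp; rewrite ltxx andbF.
  have [->|xNp] := eqVneq x (- p)%R.
    rewrite ifF; last by apply/negP; rewrite inE /= => -[_ []]; right.
    rewrite ifF ?mulr0 ?mule0 //; apply/negP; rewrite inE => /IooP.
    by rewrite dot_selfN // ltxx.
  have xI := dot_lt1 sx sp xp xNp.
  rewrite ifT; last by rewrite inE; split => // -[] /eqP; [rewrite (negbTE xp) | rewrite (negbTE xNp)].
  rewrite ifT; last by rewrite inE; apply/IooP.
  rewrite -EFinM /V /geodist; congr EFin.
  by rewrite mulrCA mulVKf // mulrDr.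
have mV : measurable_fun sphere (fun x => (V \_ (@Ioo R)) (dot x p)).
  apply: measurableT_comp; first exact: measurable_patch_Ioo.
  by apply: measurable_funTS; exact: measurable_dotl.
rewrite ge0_integralZl_EFin //; last 3 first.
- exact: measurable_sphere.
- by move=> x _; rewrite lee_fin mulr_ge0 ?sqr_ge0.
- apply/measurable_EFinP; apply: measurable_funM => //; exact: measurable_funX.
by rewrite muleA -EFinM mulVf // mul1e.
Qed.

(* The gap between the two potentials.  At the poles t = -1, 1 both are replaced
   by 0 and the gap C / 4 is still positive. *)
Let delta (t : R) : R := C / 4 + (@hardy_limit R \_ @Ioo R) t - (V \_ (@Ioo R)) t.

Let C4 : (0 < C / 4 <= 1)%R.
Proof. by case/andP: C04 => c0 c4; apply/andP; split; lra. Qed.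

Let delta_ge0 t : (0 <= delta t)%R.
Proof.
rewrite /delta !patchE; case: ifPn => [|_].
  by rewrite inE => /IooP/V_le; rewrite subr_ge0.
by rewrite addr0 subr0; case/andP: C4 => /ltW.
Qed.

Let delta_gt0 t : (t != 0)%R -> (0 < delta t)%R.
Proof.
move=> t0; rewrite /delta !patchE; case: ifPn => [|_].
  by rewrite inE => /IooP/V_lt /(_ t0); rewrite subr_gt0.
by rewrite addr0 subr0; case/andP: C4.
Qed.

Let continuous_hardy_limit (t : R) : (-1 < t < 1)%R -> {for t, continuous (@hardy_limit R)}.
Proof.
move=> ht; have q0 := one_sub_sqr_gt0 ht; have p0 := psidot_gt0 ht.
have cid : {for t, continuous (fun s : R => s)} by exact: cvg_id.
have cC (k : R) : {for t, continuous (fun _ : R => k)} by exact: cvg_cst.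
have ct2 : {for t, continuous (fun s : R => s ^+ 2)%R} by exact: (cvgM cid cid).
have cq : {for t, continuous (fun s : R => 1 - s ^+ 2)%R} by apply: cvgB; [exact: cC | exact: ct2].
have cp : {for t, continuous (@psidot R)}.
  apply: cvgB; first exact: cC.
  apply: cvgM; last exact: cC.
  by apply: continuous_comp cq _; exact: continuous_ln.
have cp2 : {for t, continuous (fun s => psidot s ^+ 2)%R} by exact: (cvgM cp cp).
apply: cvgB.
- apply: cvgM ct2 _; apply: cvgV.
    by rewrite !mulf_neq0 ?expf_neq0 ?gt_eqF.
  by apply: cvgM cp2; apply: cvgM cq; exact: cC.
- apply: cvgV; first by rewrite mulf_neq0 ?gt_eqF.
  by apply: cvgM cp; exact: cC.
Qed.

(** The integral of f^2 (1 + W) is the sum of Q(f), (1 - C/4) |f|^2 and the integral of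
    f^2 delta, and is at most |grad f|^2 + |f|^2; Q(f) = T_C(f) leaves no room for the
    last integral.  The bound C <= 4 keeps all the terms nonnegative, so that Q(f),
    not known beforehand to be finite, is never subtracted. *)
Lemma zero_of_equality f : H1 f -> Q p chi f = T C f -> H1_zero f.
Proof.
move=> [G0 fG0]; have fG : H1_gradient f (wgrad f) := xgetPex (cst 0%R) (ex_intro _ G0 fG0).
set G := wgrad f in fG; have [[mf fL] [mG GL] _] := fG.
have mS := @measurable_sphere R.
have mf2 : measurable_fun sphere (fun x => f x ^+ 2)%R by exact: measurable_funX.
have md : measurable_fun sphere (fun x => dot x p).
  by apply: measurable_funTS; exact: measurable_dotl.
have mV : measurable_fun sphere (fun x => (V \_ (@Ioo R)) (dot x p)).
  by apply: measurableT_comp md; exact: measurable_patch_Ioo.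
have mH : measurable_fun sphere (fun x => (@hardy_limit R \_ @Ioo R) (dot x p)).
  by apply: measurableT_comp md; exact: measurable_patch_Ioo.
have mD : measurable_fun sphere (fun x => delta (dot x p)).
  by apply: measurable_funB => //; apply: measurable_funD.
have V0 t : (0 <= (V \_ (@Ioo R)) t)%R.
  rewrite patchE; case: ifPn => // _.
  by rewrite /V mulr_ge0 // addr_ge0 // invr_ge0 sqr_ge0.
have B0 : 0 <= sqnormL2 f by apply: integral_ge0 => x _; rewrite lee_fin sqr_ge0.
have A0 : 0 <= sqnormL2v G by apply: integral_ge0 => x _; rewrite lee_fin sqr_ge0.
have Bfin : sqnormL2 f \is a fin_num by rewrite ge0_fin_numE.
have Afin : sqnormL2v G \is a fin_num by rewrite ge0_fin_numE.
rewrite QE // /T -/G => QT.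
set D := \int[sigma]_(x in sphere) (f x ^+ 2 * delta (dot x p))%:E.
have D0 : 0 <= D by apply: integral_ge0 => x _; rewrite lee_fin mulr_ge0 ?sqr_ge0.
have k0 : (0 <= 1 - C / 4)%R by rewrite subr_ge0; case/andP: C4.
have split_int : \int[sigma]_(x in sphere) (f x ^+ 2 * (1 + (@hardy_limit R \_ @Ioo R) (dot x p)))%:E =
    \int[sigma]_(x in sphere) (f x ^+ 2 * (V \_ (@Ioo R)) (dot x p))%:E +
    ((1 - C / 4)%:E * sqnormL2 f + D).
  rewrite /sqnormL2 -ge0_integralZl_EFin //; last 2 first.
  - by move=> x _; rewrite lee_fin sqr_ge0.
  - exact/measurable_EFinP.
  rewrite -ge0_integralD //; last 4 first.
  - by move=> x _; rewrite -EFinM lee_fin mulr_ge0 ?sqr_ge0.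
  - by apply: measurable_funeM; apply/measurable_EFinP.
  - by move=> x _; rewrite lee_fin mulr_ge0 ?sqr_ge0.
  - by apply/measurable_EFinP; exact: measurable_funM.
  rewrite -ge0_integralD //; last 4 first.
  - by move=> x _; rewrite lee_fin mulr_ge0 ?sqr_ge0.
  - by apply/measurable_EFinP; exact: measurable_funM.
  - by move=> x _; rewrite -EFinM -EFinD lee_fin addr_ge0 // mulr_ge0 ?sqr_ge0.
  - apply: emeasurable_funD; last by apply/measurable_EFinP; exact: measurable_funM.
    by apply: measurable_funeM; apply/measurable_EFinP.
  apply: eq_integral => x _; rewrite -EFinM -!EFinD; congr EFin.
  by rewrite /delta; ring.
have Dle : D <= 0.
  have := hardy_limit_inequality sp fG; rewrite split_int QT -/G.
  case/andP: C4 => c0 c1.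
  rewrite -(fineK Afin) -(fineK Bfin); case: (D) D0 => [d| |] //= _.
  by rewrite -!EFinM -!EFinD !lee_fin; lra.
have Dz : D = 0 by apply/eqP; rewrite eq_le Dle D0.
have Ez := equator_negligible sp fG.
pose E x := (f x ^+ 2 * (delta (dot x p) + (dot x p == 0%R)%:R))%R.
have mE : measurable_fun sphere (fun x => (dot x p == 0%R)%:R : R).
  exact: measurable_equator.
have E0 x : (0 <= E x)%R by rewrite mulr_ge0 ?sqr_ge0 // addr_ge0.
have intE : \int[sigma]_(x in sphere) `|(E x)%:E| = 0.
  transitivity (\int[sigma]_(x in sphere) ((f x ^+ 2 * delta (dot x p))%:E
      + (f x ^+ 2 * (dot x p == 0%R)%:R)%:E)).
    by apply: eq_integral => x _; rewrite gee0_abs ?lee_fin // -EFinD /E mulrDr.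
  rewrite ge0_integralD //; last 4 first.
  - by move=> x _; rewrite lee_fin mulr_ge0 ?sqr_ge0.
  - by apply/measurable_EFinP; exact: measurable_funM.
  - by move=> x _; rewrite lee_fin mulr_ge0 ?sqr_ge0.
  - by apply/measurable_EFinP; exact: measurable_funM.
  by rewrite -/D Dz Ez adde0.
have mEE : measurable_fun sphere (fun x => (E x)%:E).
  by apply/measurable_EFinP; apply: measurable_funM => //; exact: measurable_funD.
have [aeE _] := ae_eq_integral_abs sigma mS mEE.
apply: filterS (aeE intE) => x /= Ex sx.
have [] := Ex sx; move/eqP; rewrite mulf_eq0 sqrf_eq0 => /orP[/eqP //|].
rewrite gt_eqF //; have [->|t0] := eqVneq (dot x p) 0%R.
  by rewrite ltr_wpDl ?delta_ge0.
by rewrite addr0 delta_gt0.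
Qed.

End conclusion.

Section comparison.
Variable R : realType.
Local Notation c := (1 + ln pi : R).

Lemma acos_in (t : R) : -1 < t < 1 -> 0 < acos t < pi.
Proof. by move=> /andP[t1 t2]; rewrite acos_gt0 ?acos_ltpi ?t1 ?t2 ?ltW. Qed.

Lemma hardy_limit_acos (t : R) : -1 < t < 1 ->
  hardy_limit t =
  4^-1 * (cos (acos t) / sin (acos t) / psi (acos t)) ^+ 2 - 2^-1 / psi (acos t).
Proof.
move=> ht; have th := acos_in ht; have s0 := sin_gt0_pi th.
have ct : cos (acos t) = t by apply: acosK; rewrite in_itv /=; case/andP: ht => *; rewrite !ltW.
have s2 : 1 - t ^+ 2 = sin (acos t) ^+ 2 by have := cos2Dsin2 (acos t); rewrite ct; lra.
have pE : psidot t = psi (acos t).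
  by rewrite psiE // /psidot s2 lnXn //; move: (ln _) (ln _) => a b; lra.
have p0 : psi (acos t) != 0 by rewrite -pE gt_eqF // psidot_gt0.
rewrite /hardy_limit pE s2 ct; have s0' : sin (acos t) != 0 by rewrite gt_eqF.
by field; rewrite s0' p0.
Qed.

Lemma continuous_potential (chi : R -> R) :
  (forall s : R, 0 < s < pi -> {for s, continuous chi}) ->
  (forall s : R, 0 < s < pi -> 0 < chi s) ->
  forall t : R, -1 < t < 1 ->
  {for t, continuous (fun t => 4^-1 * ((rho chi (acos t) ^+ 2)^-1 + (rho chi (pi - acos t) ^+ 2)^-1))}.
Proof.
move=> cchi chi0 t ht; have th := acos_in ht.
have th' : 0 < pi - acos t < pi by case/andP: th => *; apply/andP; split; lra.
have ca : {for t, continuous (@acos R)} by exact: continuous_acos.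
have cb : {for t, continuous (fun t : R => pi - acos t)} by apply: cvgB; [exact: cvg_cst | exact: ca].
have k (h : R -> R) : {for t, continuous h} -> 0 < h t < pi ->
    {for t, continuous (fun t => (rho chi (h t) ^+ 2)^-1)}.
  move=> ch h0.
  have cr : {for t, continuous (fun t => rho chi (h t))}.
    by apply: cvgM; [exact: ch | apply: continuous_comp ch _; exact: cchi].
  apply: cvgV; last exact: (cvgM cr cr).
  rewrite expf_neq0 // mulf_neq0 // gt_eqF ?chi0 //; by case/andP: h0.
by apply: cvgM; [exact: cvg_cst | apply: cvgD; exact: k].
Qed.

Lemma phi_gt0 (s : R) : 0 < s < pi -> 0 < phi s.
Proof.
move=> /andP[s0 sp]; rewrite phiE //.
have : ln s <= ln pi by rewrite ler_ln ?posrE ?pi_gt0 // ltW.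
lra.
Qed.

Lemma continuous_phi (s : R) : 0 < s -> {for s, continuous (@phi R)}.
Proof.
move=> s0; apply: continuous_comp; last first.
  by apply: continuous_ln; rewrite divr_gt0 ?mulr_gt0 ?pi_gt0 ?expR_gt0.
by apply: cvgM; [exact: cvg_cst | apply: cvgV; [rewrite gt_eqF | exact: cvg_id]].
Qed.

Lemma continuous_psi (s : R) : 0 < s < pi -> {for s, continuous (@psi R)}.
Proof.
move=> hs; apply: (@continuous_comp _ _ _ (@sin R) (@phi R)); first exact: continuous_sin.
by apply: continuous_phi; exact: sin_gt0_pi.
Qed.

Lemma constant_bounds (k : R) : 1 <= k -> 0 < 2 / c + 8 / (pi ^+ 2 * k ^+ 2) <= 4.
Proof.
move=> k1; have c1 := c_ge R; have p2 := @pi_ge2 R.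
have c0 : 0 < c by lra.
have P : 4 <= pi ^+ 2 * k ^+ 2.
  rewrite -[leLHS]mulr1; apply: ler_pM => //; last by rewrite exprn_ege1.
  by clear -p2; nra.
have P0 : 0 < pi ^+ 2 * k ^+ 2 by lra.
have h1 : 0 < 2 / c by rewrite divr_gt0.
have h2 : 2 / c <= 1 by rewrite ler_pdivrMr // mul1r; lra.
have h3 : 0 < 8 / (pi ^+ 2 * k ^+ 2) by rewrite divr_gt0.
have h4 : 8 / (pi ^+ 2 * k ^+ 2) <= 2 by rewrite ler_pdivrMr //; lra.
by clear -h1 h2 h3 h4; apply/andP; split; lra.
Qed.

(** Translation of the comparison of potentials from the polar angle to
    t = cos theta; W is four times the sum of C / 4 and [hardy_limit]. *)
Lemma no_extremal (p : R3 R) (chi : R -> R) (k : R) f : sphere p -> 1 <= k ->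
  (forall s : R, 0 < s < pi -> {for s, continuous chi}) ->
  (forall s : R, 0 < s < pi -> 0 < chi s) ->
  (forall t, 0 < t < pi ->
    let V := (rho chi t ^+ 2)^-1 + (rho chi (pi - t) ^+ 2)^-1 in
    let W := 8 / (pi ^+ 2 * k ^+ 2) + (2 / c - 2 / psi t) + (cos t / sin t / psi t) ^+ 2 in
    V <= W /\ (cos t != 0 -> V < W)) ->
  H1 f -> Q p chi f = T (2 / c + 8 / (pi ^+ 2 * k ^+ 2)) f -> H1_zero f.
Proof.
move=> sp k1 cchi chi0 VW.
have E (t : R) : -1 < t < 1 -> (2 / c + 8 / (pi ^+ 2 * k ^+ 2)) / 4 + hardy_limit t =
    4^-1 * (8 / (pi ^+ 2 * k ^+ 2) + (2 / c - 2 / psi (acos t)) +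
     (cos (acos t) / sin (acos t) / psi (acos t)) ^+ 2).
  move=> ht; rewrite hardy_limit_acos //.
  move: (_ / sin _) (psi _)^-1 (c^-1) (_ / (_ * _)) => a b d e; lra.
apply: zero_of_equality => //.
- exact: constant_bounds.
- exact: continuous_potential.
- by move=> t ht; rewrite E // ler_pM2l //; have [] := VW _ (acos_in ht).
- move=> t ht t0; rewrite E // ltr_pM2l //; have [_] := VW _ (acos_in ht); apply.
  by rewrite acosK // in_itv /=; case/andP: ht => *; rewrite !ltW.
Qed.

End comparison.

Theorem theorem3 (R : realType) (p : R3 R) (hp : sphere p) :
  let A : R := 2 / (1 + ln pi) + 8 / (pi ^+ 2 * (1 + ln 2) ^+ 2) in
  let B : R := 2 / (1 + ln pi) + 8 / (pi ^+ 2 * (1 + ln pi) ^+ 2) in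
  ~ (exists f : R3 R -> R, [/\ H1 f, ~ H1_zero f & Q p (@phi R) f = T A f]) /\
  ~ (exists f : R3 R -> R, [/\ H1 f, ~ H1_zero f & Q p (@psi R) f = T B f]).
Proof.
move=> A B; split=> -[f [fH1 fn0 fQ]]; apply: fn0.
- apply: (no_extremal hp _ _ (@phi_gt0 R) (@phi_potential_le R) fH1 fQ).
    by have := @ln2_ge R; lra.
  by move=> s /andP[s0 _]; exact: continuous_phi.
- apply: (no_extremal hp _ _ _ (@psi_potential_le R) fH1 fQ).
  + by have := c_ge R; lra.
  + exact: continuous_psi.
  + move=> s /psi_ge; apply: lt_le_trans; have := c_ge R; lra.
Qed.
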